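(* Assume that the zero set $\mathfrak{Z}$ of $W$ consists of exactly two points, $\mathbf{p}_1$ and $\mathbf{p}_2$. Then there exists an $H$-minimizing heteroclinic connection between $\mathbf{p}_1$ and $\mathbf{p}_2$.
   Context: Let $N\ge 2$ and let $W:\mathbb{R}^N\to[0,\infty)$ be a continuous function with zero set $\mathfrak{Z}$ (and $W>0$ off $\mathfrak{Z}$) such that: $\liminf_{|p|\to\infty}W(p)>0$; $W\in C^{1,\alpha}_{loc}(\mathbb{R}^N\setminus\mathfrak{Z})$ for some $\alpha\in(0,1)$; and there are positive numbers $C,\delta$ such that for every $\mathbf{p}\in\mathfrak{Z}$, $W(p)\le C|p-\mathbf{p}|^2$ whenever $|p-\mathbf{p}|<\delta$. (The last condition makes $W$ differentiable at each point of $\mathfrak{Z}$ with zero gradient, so $\nabla W$ is defined everywhere.) For $U\in H^1_{loc}(\mathbb{R},\mathbb{R}^N)$ set $H(U):=\int_{-\infty}^{+\infty}\frac12|U'|^2+W(U)\,dx\in[0,\infty]$. An $H$-minimizing heteroclinic connection between $\mathbf{a},\mathbf{b}\in\mathfrak{Z}$ is a classical ($C^2$) solution $U:\mathbb{R}\to\mathbb{R}^N$ of $U''-\nabla W(U)=0$ on $\mathbb{R}$ with $U(x)\to\mathbf{a}$ as $x\to-\infty$, $U(x)\to\mathbf{b}$ as $x\to+\infty$, and $H(U)\le H(V)$ for every $V\in H^1_{loc}(\mathbb{R},\mathbb{R}^N)$ with $V(x)\to\mathbf{a}$ as $x\to-\infty$ and $V(x)\to\mathbf{b}$ as $x\to+\infty$.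 *)

(* Defs.v *)
From mathcomp Require Import all_boot all_order all_algebra.
From mathcomp Require Import all_classical all_reals all_analysis.

Set Implicit Arguments.
Unset Strict Implicit.
Unset Printing Implicit Defensive.

Import Order.TTheory GRing.Theory Num.Theory.
Import numFieldNormedType.Exports.

Local Open Scope classical_set_scope.
Local Open Scope ring_scope.

(* The library norm on 'rV[R]_N is the sup norm; all the norms |.| on R^N
   below are Euclidean. *)
Definition enorm (R : realType) (N : nat) (p : 'rV[R]_N) : R :=
  Num.sqrt (\sum_(i < N) p 0 i ^+ 2).

(* The filter |p| -> oo on R^N. *)
Definition at_infinity (R : realType) (N : nat) : set_system 'rV[R]_N :=
  filter_from [set: R] (fun M => [set p | M < enorm p]).

Definition zero_set (R : realType) (N : nat) (W : 'rV[R]_N -> R)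
  : set 'rV[R]_N := [set p | W p = 0].

Definition grad (R : realType) (N : nat) (W : 'rV[R]_N -> R) (p : 'rV[R]_N)
  : 'rV[R]_N := \row_(i < N) 'D_(delta_mx 0 i) W p.

Definition C1alpha_loc (R : realType) (N : nat) (alpha : R)
    (D : set 'rV[R]_N) (W : 'rV[R]_N -> R) : Prop :=
  [/\ forall p, D p -> differentiable W p,
      forall p, D p -> {for p, continuous (grad W)} &
      forall K : set 'rV[R]_N, compact K -> K `<=` D ->
        exists L : R, forall p q, K p -> K q ->
          enorm (grad W p - grad W q) <= L * enorm (p - q) `^ alpha].

Definition L1loc (R : realType) (N : nat) (V : R -> 'rV[R]_N) : Prop :=
  forall i, locally_integrable [set: R] (fun x => V x 0 i).

Definition L2loc (R : realType) (N : nat) (V : R -> 'rV[R]_N) : Prop :=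
  (forall i, measurable_fun [set: R] (fun x => V x 0 i)) /\
  locally_integrable [set: R] (fun x => enorm (V x) ^+ 2).

(* C^1_c test functions; they give the same weak derivatives as C^oo_c ones. *)
Definition test_function (R : realType) (phi : R -> R) : Prop :=
  [/\ forall x, derivable phi x 1, continuous (derive1 phi) &
      compact (closure [set x | phi x != 0])].

Definition is_weak_derivative (R : realType) (N : nat)
    (V g : R -> 'rV[R]_N) : Prop :=
  L1loc g /\
  forall (phi : R -> R) (i : 'I_N), test_function phi ->
    (\int[lebesgue_measure]_x (V x 0 i * derive1 phi x) =
     - \int[lebesgue_measure]_x (g x 0 i * phi x))%R.

(* V is any representative of its class; the pointwise limits in [connects]
   are those of the representative. *)
Definition H1loc (R : realType) (N : nat) (V : R -> 'rV[R]_N) : Prop :=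
  L2loc V /\ exists2 g : R -> 'rV[R]_N, L2loc g & is_weak_derivative V g.

(* A weak derivative of V, which is unique up to a null set when it exists;
   the value 0 is used only when V has none. *)
Definition weak_derivative (R : realType) (N : nat) (V : R -> 'rV[R]_N)
  : R -> 'rV[R]_N :=
  xget (fun=> 0) [set g | is_weak_derivative V g].

(* Meaningful for V in H^1_loc. *)
Definition H_energy (R : realType) (N : nat) (W : 'rV[R]_N -> R)
    (V : R -> 'rV[R]_N) : \bar R :=
  (\int[lebesgue_measure]_x
     (2^-1 * enorm (weak_derivative V x) ^+ 2 + W (V x))%R%:E)%E.

Definition connects (R : realType) (N : nat) (a b : 'rV[R]_N)
    (V : R -> 'rV[R]_N) : Prop :=
  V x @[x --> -oo] --> a /\ V x @[x --> +oo] --> b.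

Definition C2 (R : realType) (N : nat) (U : R -> 'rV[R]_N) : Prop :=
  [/\ forall x, derivable U x 1,
      forall x, derivable (derive1 U) x 1 &
      continuous (derive1 (derive1 U))].

Definition minimizing_heteroclinic (R : realType) (N : nat)
    (W : 'rV[R]_N -> R) (a b : 'rV[R]_N) (U : R -> 'rV[R]_N) : Prop :=
  [/\ C2 U,
      forall x, derive1 (derive1 U) x - grad W (U x) = 0,
      connects a b U &
      forall V : R -> 'rV[R]_N, H1loc V -> connects a b V ->
        (H_energy W U <= H_energy W V)%E].

(* Main.v *)
Require Import Defs.
From mathcomp Require Import all_boot all_order all_algebra.
From mathcomp Require Import all_classical all_reals all_analysis.
From mathcomp Require Import measurable_realfun.
From mathcomp Require Import ring lra.

(** Why there is a minimizing connection.

The energy of a curve [u] is encoded by two nondecreasing functions of time, its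
profiles: a kinetic one [q], whose increments satisfy
[|u t - u s|^2 <= 2 (t - s) (q t - q s)], and a potential one [p], whose increments
dominate [w (t - s)] whenever [w <= W] along the curve on [[s, t]].  These
inequalities are additive under concatenation of curves ([profile_join]) and
closed under pointwise limits ([profile_limit]), so the direct method works with
them as it does with integrals, and weak compactness in L2 is replaced by
compactness at each time.  Let [m] be the infimum of the increments of [q + p]
over the whole line, for curves joining the two wells.

Existence ([exists_minimizer]).  Translate the curves of a minimizing sequence so
that they leave a ball around the first well for the last time at time 0, and take
the limit along an ultrafilter.  A curve of finite energy is Hölder continuous and
pays at least a fixed price for each stay away from both wells ([escape_cost]), so
the limit curve tends to a well at each end.  At [+oo] it cannot be the first well,
by the normalization.  At [-oo] it cannot be the second one: a curve close to
the second well at a negative time could be sent there at once for almost no cost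
([shortcut]), saving the price of the stay that begins at time 0.

Euler-Lagrange equation.  The gradient of [W] is continuous only off the wells, so
one first shows that the minimizer [u] never meets them ([avoids_wells]).  Running
through a piece of [u] at half speed must not pay, which bounds its kinetic energy
by a multiple of the potential one ([kinetic_le_potential]); as [W] is at most
quadratic near a well, the speed is then at most proportional to the distance to the
well, and a curve that meets the well stays there forever.  Off the wells,
adding small tents to [u] and expanding [W] shows that the symmetric second
differences of each coordinate are [h^2 grad W (u t) + o(h^2)]
([second_difference]).  Subtracting a second primitive of [grad W (u t)] leaves a
continuous function with vanishing symmetric second derivative, which is affine by
Schwarz's theorem ([schwarz_affine]).  So [u] is C2 and solves the equation.

Comparison with H1loc.  For a competitor [V] of finite energy, testing the weak
derivative against smooth steps shows that [V] agrees almost everywhere with a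
continuous curve whose increments are integrals of the weak derivative
([weak_increment], [weak_derivative_primitive]); by Cauchy-Schwarz the partial
integrals of the energy of [V] are profiles of that curve, so [m <= H(V)]
([H1loc_admissible]).  Conversely, [u] being C1, the profiles grow at least
as fast as the integral of its energy density ([energy_integral_le]), and its weak
derivative is the classical one, so [H(u) <= m] ([H_energy_classical_le]). *)

Set Implicit Arguments.
Unset Strict Implicit.
Unset Printing Implicit Defensive.

Import Order.TTheory GRing.Theory Num.Theory.
Import numFieldNormedType.Exports.

Local Open Scope classical_set_scope.
Local Open Scope ring_scope.

(** * The squared Euclidean norm *)

Definition dotp (R : realType) (N : nat) (x y : 'rV[R]_N) : R :=
  \sum_(i < N) x 0 i * y 0 i.

Definition sqn (R : realType) (N : nat) (x : 'rV[R]_N) : R :=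
  \sum_(i < N) x 0 i ^+ 2.

Section SquareNorm.
Context {R : realType} {N : nat}.
Implicit Types x y z : 'rV[R]_N.

Lemma sqn_ge0 x : 0 <= sqn x.
Proof. by apply: sumr_ge0 => i _; exact: sqr_ge0. Qed.

Lemma enorm_sqr x : enorm x ^+ 2 = sqn x.
Proof. by rewrite sqr_sqrtr// sqn_ge0. Qed.

Lemma enorm_ge0 x : 0 <= enorm x.
Proof. exact: sqrtr_ge0. Qed.

Lemma enorm_lt x (r : R) : 0 < r -> (enorm x < r) = (sqn x < r ^+ 2).
Proof.
move=> r0; rewrite -enorm_sqr ltr_pXn2r// nnegrE ?enorm_ge0//; exact: ltW.
Qed.

Lemma enorm_gt x (r : R) : 0 <= r -> (r < enorm x) = (r ^+ 2 < sqn x).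
Proof.
by move=> r0; rewrite -enorm_sqr ltr_pXn2r// nnegrE ?enorm_ge0.
Qed.

Lemma sqn0 : sqn (0 : 'rV[R]_N) = 0.
Proof. by rewrite /sqn big1// => i _; rewrite mxE expr0n. Qed.

Lemma sqnN x : sqn (- x) = sqn x.
Proof. by apply: eq_bigr => i _; rewrite mxE sqrrN. Qed.

Lemma sqnB x y : sqn (x - y) = sqn (y - x).
Proof. by rewrite -sqnN opprB. Qed.

Lemma sqnZ a x : sqn (a *: x) = a ^+ 2 * sqn x.
Proof.
by rewrite /sqn mulr_sumr; apply: eq_bigr => i _; rewrite mxE exprMn.
Qed.

Lemma sqn_coord x i : x 0 i ^+ 2 <= sqn x.
Proof.
rewrite /sqn (bigD1 i)//= lerDl; apply: sumr_ge0 => j _; exact: sqr_ge0.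
Qed.

Lemma sqn_eq0 x : sqn x <= 0 -> x = 0.
Proof.
move=> x0; apply/matrixP => i j; rewrite (ord1 i) mxE.
apply/eqP; rewrite -sqrf_eq0; apply/eqP/le_anti; rewrite sqr_ge0 andbT.
exact: le_trans (sqn_coord x j) x0.
Qed.

Lemma sqnD x y : sqn (x + y) = sqn x + 2 * dotp x y + sqn y.
Proof.
rewrite /sqn /dotp mulr_sumr -!big_split/=; apply: eq_bigr => i _.
by rewrite !mxE; ring.
Qed.

Lemma dotpC x y : dotp x y = dotp y x.
Proof. by apply: eq_bigr => i _; rewrite mulrC. Qed.

Lemma dotpZl a x y : dotp (a *: x) y = a * dotp x y.
Proof.
by rewrite /dotp mulr_sumr; apply: eq_bigr => i _; rewrite mxE mulrA.
Qed.

Lemma dotpNl x y : dotp (- x) y = - dotp x y.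
Proof. by rewrite -scaleN1r dotpZl mulN1r. Qed.

Lemma sqnD_le2 x y : sqn (x + y) <= 2 * sqn x + 2 * sqn y.
Proof.
have := sqn_ge0 (x - y); rewrite !sqnD sqnN (dotpC _ (- y)) dotpNl dotpC; lra.
Qed.

(** The weighted triangle inequality: it is [|b x - a y|^2 >= 0] expanded. *)
Lemma sqn_young (a b : R) x y : 0 < a -> 0 < b ->
  a * b * sqn (x + y) <= (a + b) * (b * sqn x + a * sqn y).
Proof.
move=> a0 b0; have := sqn_ge0 (b *: x - a *: y).
rewrite !sqnD sqnN !sqnZ dotpZl (dotpC _ (- _)) dotpNl dotpZl (dotpC y x).
by set X := sqn x; set Y := sqn y; set D := dotp x y; nra.
Qed.

(** Convexity of [|x|^2 / a] in [(a, x)]: the kinetic costs of two consecutive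
time intervals bound that of their union. *)
Lemma sqn_concat (a b A B : R) x y : 0 <= a -> 0 <= b -> 0 <= A -> 0 <= B ->
  sqn x <= 2 * a * A -> sqn y <= 2 * b * B ->
  sqn (x + y) <= 2 * (a + b) * (A + B).
Proof.
move=> a0 b0 A0 B0; move: a0 b0; rewrite [0 <= a]le_eqVlt [0 <= b]le_eqVlt.
move=> /predU1P[<-|a0] /predU1P[<-|b0]; rewrite ?(mulr0, mul0r).
- by move=> /sqn_eq0 -> /sqn_eq0 ->; rewrite !addr0 sqn0 mulr0 mul0r.
- move=> /sqn_eq0 -> h; rewrite !add0r.
  by apply: (le_trans h); rewrite ler_pM2l ?lerDr// mulr_gt0.
- move=> h /sqn_eq0 ->; rewrite !addr0.
  by apply: (le_trans h); rewrite ler_pM2l ?lerDl// mulr_gt0.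
move=> hx hy.
have := sqn_young x y a0 b0 => h.
rewrite -(ler_pM2l (mulr_gt0 a0 b0)) (le_trans h)//.
have -> : a * b * (2 * (a + b) * (A + B)) =
  (a + b) * (b * (2 * a * A) + a * (2 * b * B)) by ring.
rewrite ler_pM2l ?addr_gt0//; apply: lerD; rewrite ler_pM2l//.
Qed.

End SquareNorm.

(** * Curves with energy profiles *)

(** A kinetic profile of [u] is a function [q] whose increments dominate the
kinetic energy, by Cauchy-Schwarz the least energy needed to join [u s] to [u t]
in the time [t - s].  For absolutely continuous [u] the best one is the integral
of [|u'|^2 / 2]. *)
Definition kinetic_profile (R : realType) (N : nat) (I : set R)
    (u : R -> 'rV[R]_N) (q : R -> R) : Prop :=
  forall s t, I s -> I t -> s <= t ->
    sqn (u t - u s) <= 2 * (t - s) * (q t - q s).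

(** The increments of [p] dominate the lower Darboux sums of the integral of
[W \o u]. *)
Definition potential_profile (R : realType) (N : nat) (W : 'rV[R]_N -> R)
    (I : set R) (u : R -> 'rV[R]_N) (p : R -> R) : Prop :=
  forall s t w, I s -> I t -> s <= t ->
    (forall r, s <= r <= t -> w <= W (u r)) -> w * (t - s) <= p t - p s.

Definition profile (R : realType) (N : nat) (W : 'rV[R]_N -> R)
    (I : set R) (u : R -> 'rV[R]_N) (q p : R -> R) : Prop :=
  kinetic_profile I u q /\ potential_profile W I u p.

Definition tends_Ny (R : realType) (N : nat) (u : R -> 'rV[R]_N)
    (a : 'rV[R]_N) : Prop :=
  forall e, 0 < e -> exists T, forall t, t <= T -> sqn (u t - a) < e.

Definition tends_y (R : realType) (N : nat) (u : R -> 'rV[R]_N)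
    (b : 'rV[R]_N) : Prop :=
  forall e, 0 < e -> exists T, forall t, T <= t -> sqn (u t - b) < e.

Definition energy_le (R : realType) (M : R) (q p : R -> R) : Prop :=
  forall s t, s <= t -> (q t + p t) - (q s + p s) <= M.

Definition admissible (R : realType) (N : nat) (W : 'rV[R]_N -> R)
    (a b : 'rV[R]_N) (M : R) (u : R -> 'rV[R]_N) (q p : R -> R) : Prop :=
  [/\ profile W setT u q p, tends_Ny u a, tends_y u b & energy_le M q p].

Definition join_at (R : realType) (T : Type) (c : R) (f g : R -> T) (t : R) : T :=
  if t <= c then f t else g t.

Section Profiles.
Context {R : realType} {N : nat} {W : 'rV[R]_N -> R}.
Hypothesis W_ge0 : forall p, 0 <= W p.
Implicit Types (I : set R) (u v : R -> 'rV[R]_N) (q p : R -> R).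

Lemma kinetic_mono I u q s t : kinetic_profile I u q ->
  I s -> I t -> s <= t -> q s <= q t.
Proof.
move=> k Is It; rewrite le_eqVlt => /predU1P[->//|st].
have := le_trans (sqn_ge0 _) (k _ _ Is It (ltW st)).
by rewrite pmulr_rge0 ?subr_ge0// mulr_gt0// subr_gt0.
Qed.

Lemma potential_mono I u p s t : potential_profile W I u p ->
  I s -> I t -> s <= t -> p s <= p t.
Proof.
move=> k Is It st; have := k s t 0 Is It st (fun _ _ => W_ge0 _).
by rewrite mul0r subr_ge0.
Qed.

Lemma profile_sub I J u q p : J `<=` I ->
  profile W I u q p -> profile W J u q p.
Proof.
move=> JI [k h]; split; first by move=> s t /JI Is /JI It; exact: k.
by move=> s t w /JI Is /JI It; exact: h.
Qed.

Lemma profile_addc I u q p a b : profile W I u q p ->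
  profile W I u (fun t => q t + a) (fun t => p t + b).
Proof.
move=> [k h]; split=> [s t|s t w] Is It st; first by have := k s t Is It st; lra.
by move=> hw; have := h s t w Is It st hw; lra.
Qed.

Lemma profile_shift I u q p a : profile W I u q p ->
  profile W [set t | I (t + a)] (fun t => u (t + a)) (fun t => q (t + a))
    (fun t => p (t + a)).
Proof.
move=> [k h]; split=> [s t|s t w] /= Is It st.
  have := k _ _ Is It; rewrite lerD2r => /(_ st).
  by have -> : t + a - (s + a) = t - s by ring.
move=> hw; have := h _ _ w Is It; rewrite lerD2r => /(_ st).
have -> : t + a - (s + a) = t - s by ring.
apply=> r rst; have := hw (r - a); rewrite subrK; apply.
by rewrite lerBrDr lerBlDr.
Qed.

(** Increments of profiles add up; an interval across [c] is cut at [c], where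
the kinetic cost is convex. *)
Lemma profile_join I J c u v q p q' p' :
  profile W I u q p -> profile W J v q' p' -> I c -> J c ->
  u c = v c -> q c = q' c -> p c = p' c ->
  profile W [set t | if t <= c then I t else J t]
    (join_at c u v) (join_at c q q') (join_at c p p').
Proof.
move=> [k1 h1] [k2 h2] Ic Jc uv qq pp.
have gE t : c <= t -> (join_at c u v t = v t) * (join_at c q q' t = q' t) *
    (join_at c p p' t = p' t).
  rewrite /join_at le_eqVlt => /predU1P[<-|]; last by rewrite ltNge => /negbTE ->.
  by rewrite lexx uv qq pp.
have gE' t : t <= c -> (join_at c u v t = u t) * (join_at c q q' t = q t) *
    (join_at c p p' t = p t) by rewrite /join_at => ->.
split=> [s t|s t w] /=.
  have [sc|cs] := leP s c.
    have [tc|ct] := leP t c => Is It st.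
      by rewrite !gE'//; exact: k1.
    rewrite !(gE' s sc) !(gE t (ltW ct)).
    have -> : v t - u s = (u c - u s) + (v t - v c).
      by rewrite uv [RHS]addrC addrA subrK.
    have -> : q' t - q s = (q c - q s) + (q' t - q' c) by rewrite qq; ring.
    have -> : t - s = (c - s) + (t - c) by ring.
    apply: sqn_concat; rewrite ?subr_ge0 ?(ltW ct)//.
    - exact: kinetic_mono k1 _ _ _.
    - by apply: kinetic_mono k2 _ _ _ => //; exact: ltW.
    - exact: k1.
    - by apply: k2 => //; exact: ltW.
  move=> Js; case: leP => [tc Is st|ct Jt st].
    by move: (lt_le_trans cs (le_trans st tc)); rewrite ltxx.
  by rewrite !gE ?(ltW ct) ?(ltW cs)//; exact: k2.
have [sc|cs] := leP s c.
  have [tc|ct] := leP t c => Is It st hw.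
    rewrite !gE'//; apply: h1 => // r /andP[sr rt].
    by have := hw r; rewrite sr rt gE' ?(le_trans rt)//; exact.
  rewrite !(gE' s sc) !(gE t (ltW ct)).
  have -> : p' t - p s = (p c - p s) + (p' t - p' c) by rewrite pp; ring.
  have -> : t - s = (c - s) + (t - c) by ring.
  rewrite mulrDr; apply: lerD.
    apply: h1 => // r /andP[sr rc]; have := hw r.
    by rewrite sr (le_trans rc (ltW ct)) gE'//; exact.
  apply: h2 => //; first exact: ltW.
  move=> r /andP[cr rt]; have := hw r.
  by rewrite rt (le_trans sc cr) gE//; exact.
move=> Js; case: leP => [tc Is st|ct Jt st hw].
  by move: (lt_le_trans cs (le_trans st tc)); rewrite ltxx.
rewrite !gE ?(ltW ct) ?(ltW cs)//; apply: h2 => // r /andP[sr rt].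
by have := hw r; rewrite sr rt gE ?(ltW (lt_le_trans cs sr))//; exact.
Qed.

Lemma profile_cst I (z : 'rV[R]_N) : W z = 0 ->
  profile W I (fun=> z) (fun=> 0) (fun=> 0).
Proof.
move=> Wz; split=> [s t _ _ _|s t w _ _ st hw].
  by rewrite !subrr sqn0 mulr0.
rewrite subrr; apply: mulr_le0_ge0; last by rewrite subr_ge0.
by rewrite -Wz; apply: (hw s); rewrite lexx.
Qed.

Lemma potential_profile_le I u B : (forall t, I t -> W (u t) <= B) ->
  potential_profile W I u (fun t => B * t).
Proof.
move=> hB s t w Is It st hw; rewrite -mulrBr ler_wpM2r ?subr_ge0//.
by apply: le_trans (hB _ Is); apply: hw; rewrite lexx st.
Qed.

Lemma profile_segment (x y : 'rV[R]_N) B :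
  (forall t, 0 <= t <= 1 -> W (x + t *: (y - x)) <= B) ->
  profile W `[0, 1] (fun t => x + t *: (y - x))
    (fun t => 2^-1 * sqn (y - x) * t) (fun t => B * t).
Proof.
move=> hB; split; last first.
  by apply: potential_profile_le => t; rewrite /= in_itv/=; exact: hB.
move=> s t _ _ st.
have -> : x + t *: (y - x) - (x + s *: (y - x)) = (t - s) *: (y - x).
  by rewrite opprD addrACA subrr add0r scalerBl.
rewrite sqnZ; set S := sqn _.
have -> : 2 * (t - s) * (2^-1 * S * t - 2^-1 * S * s) = (t - s) ^+ 2 * S by field.
exact: lexx.
Qed.

(** Splicing: follow [u] up to time [a0], then [v] on [[c, d]], then [w] from
time [b0] on.  The profiles being additive, so are the energy bounds. *)
Lemma splice a b (a0 b0 c d M : R) u q p v q' p' w q'' p'' :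
  profile W setT u q p -> tends_Ny u a ->
  profile W setT w q'' p'' -> tends_y w b ->
  profile W `[c, d] v q' p' -> c <= d -> v c = u a0 -> v d = w b0 ->
  (forall s t, s <= a0 -> b0 <= t ->
    (q a0 + p a0) - (q s + p s) + ((q'' t + p'' t) - (q'' b0 + p'' b0)) <= M) ->
  exists x y z, admissible W a b (M + ((q' d + p' d) - (q' c + p' c))) x y z.
Proof.
move=> Pu ua Pw wb Pv cd vc vd hM.
have Pu1 := profile_addc (q' c - q a0) (p' c - p a0)
  (profile_shift (a0 - c) Pu).
have Pw1 := profile_addc (q' d - q'' b0) (p' d - p'' b0)
  (profile_shift (b0 - d) Pw).
have ca : c + (a0 - c) = a0 by ring.
have db : d + (b0 - d) = b0 by ring.
have Ic : `[c, d]%classic c by rewrite /= in_itv/= lexx cd.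
have Id : `[c, d]%classic d by rewrite /= in_itv/= lexx cd.
have P1 := profile_join Pu1 Pv I Ic.
rewrite /= ca vc addrC subrK addrC subrK in P1.
have {}P1 := P1 erefl erefl erefl.
set u1 := join_at c _ v in P1; set q1 := join_at c _ q' in P1.
set p1 := join_at c _ p' in P1.
have gd T (f g : R -> T) : f c = g c -> join_at c f g d = g d.
  move=> fg; rewrite /join_at; case: leP => // dc.
  by have <- : c = d by apply/le_anti; rewrite cd dc.
have u1d : u1 d = w b0 by rewrite /u1 gd//= ca.
have q1d : q1 d = q' d by rewrite /q1 gd//= ca addrC subrK.
have p1d : p1 d = p' d by rewrite /p1 gd//= ca addrC subrK.
have P1d : (if d <= c then setT (d + (a0 - c)) else `[c, d]%classic d).
  by case: ifP => // _; rewrite in_itv/= lexx cd.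
have P2 := @profile_join _ _ d _ _ _ _ _ _ P1 Pw1 P1d I.
rewrite /= db u1d q1d p1d in P2.
have := P2 erefl; rewrite addrC subrK => /(_ erefl).
rewrite addrC subrK => /(_ erefl) {}P2.
set x := join_at d u1 _ in P2; set y := join_at d q1 _ in P2.
set z := join_at d p1 _ in P2.
have {}P2 : profile W setT x y z.
  apply: profile_sub P2 => t _ /=.
  by case: leP => // td; case: leP => // ct; rewrite in_itv/= td (ltW ct).
exists x, y, z; split=> //.
- move=> e e0; have [T hT] := ua _ e0; exists (Num.min c (T + c - a0)) => t.
  rewrite le_min => /andP[tc tT]; rewrite /x /u1 /join_at (le_trans tc cd) tc.
  by apply: hT; lra.
- move=> e e0; have [T hT] := wb _ e0.
  exists (Num.max (d + 1) (T + d - b0)) => t.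
  rewrite ge_max => /andP[td tT]; rewrite /x /u1 /join_at.
  have -> : t <= d = false by apply/negbTE; rewrite -ltNge; lra.
  by apply: hT; lra.
- have yE t : d <= t -> y t = q'' (t + (b0 - d)) + (q' d - q'' b0).
    rewrite /y /join_at => dt; case: leP => // td.
    have -> : t = d by apply/le_anti; rewrite td dt.
    by rewrite q1d db; ring.
  have zE t : d <= t -> z t = p'' (t + (b0 - d)) + (p' d - p'' b0).
    rewrite /z /join_at => dt; case: leP => // td.
    have -> : t = d by apply/le_anti; rewrite td dt.
    by rewrite p1d db; ring.
  have yE' t : t <= c -> y t = q (t + (a0 - c)) + (q' c - q a0).
    by rewrite /y /q1 /join_at => tc; rewrite (le_trans tc cd) tc.
  have zE' t : t <= c -> z t = p (t + (a0 - c)) + (p' c - p a0).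
    by rewrite /z /p1 /join_at => tc; rewrite (le_trans tc cd) tc.
  move=> s t st.
  set s' := Num.min s c; set t' := Num.max t d.
  have s's : s' <= s by rewrite ge_min lexx.
  have tt' : t <= t' by rewrite le_max lexx.
  have s'c : s' <= c by rewrite ge_min lexx orbT.
  have dt' : d <= t' by rewrite le_max lexx orbT.
  have [k2 h2] := P2.
  have y1 := kinetic_mono k2 I I s's; have y2 := kinetic_mono k2 I I tt'.
  have z1 := potential_mono h2 I I s's; have z2 := potential_mono h2 I I tt'.
  have := hM (s' + (a0 - c)) (t' + (b0 - d)).
  rewrite (yE' _ s'c) in y1; rewrite (zE' _ s'c) in z1.
  rewrite (yE _ dt') in y2; rewrite (zE _ dt') in z2.
  have e1 : s' + (a0 - c) <= a0 by lra.
  have e2 : b0 <= t' + (b0 - d) by lra.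
  by move=> /(_ e1 e2); lra.
Qed.

End Profiles.

(** * Topology of row vectors through the squared Euclidean norm *)

Section Topology.
Context {R : realType} {N : nat}.
Implicit Types x y z : 'rV[R]_N.

Lemma ball_sqn x y (e : R) : 0 < e -> sqn (y - x) < e ^+ 2 -> ball x e y.
Proof.
move=> e0 h; split=> // i j; rewrite (ord1 i) {i} -ball_normE/=.
rewrite -(ltr_pXn2r (n := 2))// ?nnegrE ?normr_ge0 ?(ltW e0)//.
rewrite real_normK ?num_real// -sqrrN opprB.
by have := sqn_coord (y - x) j; rewrite !mxE => /le_lt_trans; apply.
Qed.

Lemma sqn_ball x y (e : R) : ball x e y -> sqn (y - x) <= N%:R * e ^+ 2.
Proof.
case=> e0 h; rewrite -[N in N%:R]card_ord -sumr_const mulr_suml.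
apply: ler_sum => i _; have := h 0 i; rewrite -ball_normE/= mul1r !mxE => /ltW.
rewrite -(ler_pXn2r (n := 2))// ?nnegrE ?normr_ge0 ?(ltW e0)//.
by rewrite real_normK ?num_real// -sqrrN opprB.
Qed.

Lemma near_sqn x (A : set 'rV[R]_N) : nbhs x A ->
  exists2 r, 0 < r & forall y, sqn (y - x) < r -> A y.
Proof.
move=> /nbhs_ballP[e /= e0 h]; exists (e ^+ 2); first by rewrite exprn_gt0.
by move=> y /(ball_sqn e0) /h.
Qed.

Lemma sqn_near x (A : set 'rV[R]_N) r : 0 < r ->
  (forall y, sqn (y - x) < r -> A y) -> nbhs x A.
Proof.
move=> r0 h; apply/nbhs_ballP.
have N1 : 0 < N.+1%:R :> R by rewrite ltr0n.
exists (Num.sqrt (r / N.+1%:R)) => /=; first by rewrite sqrtr_gt0 divr_gt0.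
move=> y /sqn_ball; rewrite sqr_sqrtr; last by rewrite ltW// divr_gt0.
move=> hy; apply/h/(le_lt_trans hy).
by rewrite mulrCA gtr_pMr// ltr_pdivrMr// mul1r ltr_nat.
Qed.

Lemma sqn_cvgP (T : Type) (F : set_system T) (f : T -> 'rV[R]_N)
    (l : 'rV[R]_N) :
  Filter F -> f @ F --> l <->
  forall e : R, 0 < e -> \forall t \near F, sqn (f t - l) < e.
Proof.
move=> FF; split=> [fl e e0|h A /near_sqn[r r0 hr]].
  apply: (fl [set x | sqn (x - l) < e]); exact: (sqn_near e0).
have FA := h r r0; rewrite /nbhs/=; apply: filterS FA => t; exact: hr.
Qed.

Lemma continuous_sum_sqr (T : topologicalType) (I : Type) (s : seq I)
    (c : I -> T -> R) : (forall i, continuous (c i)) ->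
  continuous (fun t => \sum_(i <- s) c i t ^+ 2).
Proof.
move=> hc t; elim: s => [|i s ih]; rewrite /continuous_at.
  by rewrite big_nil; under eq_fun do rewrite big_nil; exact: cvg_cst.
rewrite big_cons; under eq_fun do rewrite big_cons.
by apply: cvgD ih; exact: (cvgM (hc i t) (hc i t)).
Qed.

Lemma sqn_continuous (a : 'rV[R]_N) : continuous (fun x => sqn (x - a)).
Proof.
have -> : (fun x => sqn (x - a)) =
    (fun x : 'rV[R]_N => \sum_(i < N) (x 0 i - a 0 i) ^+ 2).
  by apply/funext => x; apply: eq_bigr => i _; rewrite !mxE.
apply: continuous_sum_sqr => i x.
by apply: (@continuousB _ _ 'rV[R]_N (fun x => x 0 i) (fun=> a 0 i));
  [exact: coord_continuous|exact: cst_continuous].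
Qed.

Lemma cvg_sqn (T : Type) (F : set_system T) (f : T -> 'rV[R]_N) (l : 'rV[R]_N) :
  Filter F -> f @ F --> l -> sqn (f t) @[t --> F] --> sqn l.
Proof.
move=> FF fl; have := continuous_cvg _ (@sqn_continuous 0 l) fl.
have -> : (fun x : 'rV[R]_N => sqn (x - 0)) = @sqn R N.
  by apply/funext => x; rewrite subr0.
by rewrite subr0; exact.
Qed.

Lemma closed_sqn_ge (a : 'rV[R]_N) r : closed [set x | r <= sqn (x - a)].
Proof.
have := @closed_comp _ _ (fun x => sqn (x - a)) _ (fun x _ => @sqn_continuous a x).
by move=> /(_ _ (@closed_ge _ r)).
Qed.

Lemma closed_sqn_le (a : 'rV[R]_N) r : closed [set x | sqn (x - a) <= r].
Proof.
have := @closed_comp _ _ (fun x => sqn (x - a)) _ (fun x _ => @sqn_continuous a x).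
by move=> /(_ _ (@closed_le _ r)).
Qed.

Lemma compact_sqn_le (a : 'rV[R]_N) r : compact [set x | sqn (x - a) <= r].
Proof.
apply: bounded_closed_compact; last exact: closed_sqn_le.
have r1 : 0 < Num.max r 1 by rewrite lt_max ltr01 orbT.
exists (`|a| + Num.max r 1 + 1); split; first exact: num_real.
move=> M hM x /= hx; rewrite -(subrK a x) (le_trans (ler_normD _ _))//.
rewrite addrC (le_trans _ (ltW hM))// -addrA lerD2l.
have : ball 0 (Num.max r 1 + 1) (x - a).
  apply: ball_sqn; first by rewrite addr_gt0.
  rewrite subr0 (le_lt_trans hx)//.
  have : r <= Num.max r 1 by rewrite le_max lexx.
  by move: r1; set m := Num.max r 1 => *; nra.
by rewrite mx_norm_ball /ball_/= sub0r normrN => /ltW.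
Qed.

Lemma continuous_coord (u : R -> 'rV[R]_N) i :
  continuous u -> continuous (fun t : R => u t 0 i : R).
Proof.
move=> cu t.
exact: (continuous_cvg _ (@coord_continuous R 1 N 0 i (u t)) (cu t)).
Qed.

End Topology.

(** * Limits of curves with profiles *)

Section Limits.
Context {R : realType} {N : nat}.

(** Along one ultrafilter every bounded sequence converges: pointwise limits of a
sequence of curves at all times need no extraction of subsequences. *)
Lemma ultra_compact_cvg (T : topologicalType) (I : Type) (G : set_system I)
    (f : I -> T) (K : set T) : UltraFilter G -> compact K ->
  (forall i, K (f i)) -> exists2 l, K l & f @ G --> l.
Proof.
move=> GU cK fK.
have [l [Kl cl]] : K `&` cluster (f @ G) !=set0.
  have GP : ProperFilter G := ultra_proper.
  apply: cK; rewrite /= /nbhs/=; exact: filterE.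
exists l => // A lA; have [//|GA] := in_ultra_setVsetC (f @^-1` A) GU.
by have [x []] := cl (~` A) A GA lA.
Qed.

Lemma kinetic_holder (u : R -> 'rV[R]_N) q M :
  kinetic_profile setT u q -> (forall s t, s <= t -> q t - q s <= M) ->
  forall s t, sqn (u t - u s) <= 2 * M * `|t - s|.
Proof.
move=> k hM; have h s t : s <= t -> sqn (u t - u s) <= 2 * M * `|t - s|.
  move=> st; apply: le_trans (k _ _ I I st) _.
  rewrite ger0_norm ?subr_ge0// [2 * M * _]mulrAC; apply: ler_wpM2l; last exact: hM.
  by rewrite mulr_ge0// subr_ge0.
move=> s t; have [/h//|/ltW/h] := leP s t.
by rewrite sqnB distrC.
Qed.

Lemma near_dist (t e : R) : 0 < e -> \forall s \near t, `|t - s| < e.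
Proof.
by move=> e0; apply/nbhs_ballP; exists e => //= s; rewrite -ball_normE.
Qed.

Lemma holder_cvg (M : R) (u : R -> 'rV[R]_N) (t : R) e : 0 < e ->
  (forall s r, sqn (u r - u s) <= 2 * M * `|r - s|) ->
  \forall s \near t, sqn (u s - u t) < e.
Proof.
move=> e0 h; have M1 : 0 < 2 * (`|M| + 1) by rewrite mulr_gt0// ltr_wpDl.
near=> s; apply: le_lt_trans (h _ _) _.
have : `|t - s| < e / (2 * (`|M| + 1)).
  near: s; apply: near_dist; rewrite divr_gt0//.
rewrite ltr_pdivlMr// distrC => /(le_lt_trans _); apply.
rewrite mulrC; apply: ler_wpM2l => //; apply: ler_wpM2l => //.
by rewrite (le_trans (ler_norm _))// lerDl.
Unshelve. all: by end_near. Qed.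

(** The bound [w <= W (u r)] in a potential profile is tested on a whole
interval, so pointwise convergence does not pass to the limit by itself: the
uniform Hölder bound makes it uniform on that compact interval. *)
Lemma profile_limit (W : 'rV[R]_N -> R) (G : set_system nat)
    (M : R) (u : nat -> R -> 'rV[R]_N) q p u' q' p' :
  ProperFilter G -> continuous W ->
  (forall n, profile W setT (u n) (q n) (p n)) ->
  (forall n s t, s <= t -> q n t - q n s <= M) ->
  (forall t, u n t @[n --> G] --> u' t) ->
  (forall t, q n t @[n --> G] --> q' t) ->
  (forall t, p n t @[n --> G] --> p' t) ->
  profile W setT u' q' p'.
Proof.
move=> FG Wc P qM uc qc pc.
have hol n := kinetic_holder (P n).1 (qM n).
split=> [s t _ _ st|s t w _ _ st hw].
  apply/ler_addgt0Pr => e e0.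
  have cB : 2 * (t - s) * (q n t - q n s) @[n --> G] -->
      2 * (t - s) * (q' t - q' s).
    by apply: cvgM; [exact: cvg_cst|apply: cvgB; [exact: qc|exact: qc]].
  have cu : u n t - u n s @[n --> G] --> u' t - u' s.
    by apply: cvgB; exact: uc.
  have cS : sqn (u n t - u n s) @[n --> G] --> sqn (u' t - u' s).
    exact: cvg_sqn cu.
  apply: (@le_trans _ _ (2 * (t - s) * (q' t - q' s))); last by rewrite lerDl ltW.
  apply: (ler_cvg_to cS cB); apply: nearW => n; exact: (P n).1.
apply/ler_addgt0Pr => e e0.
have d0 : 0 < e / (t - s + 1) by rewrite divr_gt0// ltr_wpDl// subr_ge0.
have : \near G, `[s, t] `<=` (fun n r => w - e / (t - s + 1) <= W (u n r)) G.
  have /compact_near_coveringP := @segment_compact R s t.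
  apply => r; rewrite /= in_itv/= => rst.
  have /near_sqn[d dgt hd] : nbhs (u' r) [set y | `|W (u' r) - W y| < e / (t - s + 1)].
    by have /cvgrPdist_lt := Wc (u' r); apply.
  have cM : 0 < 2 * (`|M| + 1) by rewrite mulr_gt0// ltr_wpDl.
  near=> r' n => /=.
  have : sqn (u n r' - u' r) < d.
    rewrite -[_ - _](subrKA (u n r)) (le_lt_trans (sqnD_le2 _ _))//.
    have : sqn (u n r' - u n r) < d / 4.
      apply: le_lt_trans (hol n _ _) _.
      have : `|r - r'| < d / 4 / (2 * (`|M| + 1)).
        by near: r'; apply: near_dist; rewrite !divr_gt0//.
      rewrite ltr_pdivlMr// distrC => /(le_lt_trans _); apply.
      rewrite mulrC; apply: ler_wpM2l => //; apply: ler_wpM2l => //.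
      by rewrite (le_trans (ler_norm _))// lerDl.
    have : sqn (u n r - u' r) < d / 4.
      near: n; apply: (iffLR (sqn_cvgP _ _ _) (uc r)); rewrite divr_gt0//.
    lra.
  move=> /hd /=; rewrite ltr_norml => /andP[_].
  by have := hw r rst; lra.
move=> near1.
have cp : p n t - p n s @[n --> G] --> p' t - p' s by apply: cvgB; exact: pc.
rewrite -lerBlDr; apply: (cvgr_to_ge cp).
apply: filterS near1 => n hn /=.
have h : (w - e / (t - s + 1)) * (t - s) <= p n t - p n s.
  by apply: (P n).2 => // r rst; apply: hn; rewrite /= in_itv.
apply: le_trans h.
rewrite mulrBl lerB// mulrAC ler_pdivrMr; last by rewrite ltr_wpDl// subr_ge0.
by rewrite ler_pM2l// lerDl.
Unshelve. all: by end_near. Qed.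

End Limits.

(** * Curves of finite energy between two wells *)

Section Wells.
Context {R : realType} {N : nat} {W : 'rV[R]_N -> R} {a b : 'rV[R]_N}.
Hypothesis W_ge0 : forall x, 0 <= W x.
Hypothesis W_cont : continuous W.
Hypothesis W_zero : forall x, W x = 0 <-> x = a \/ x = b.
Hypothesis W_far : exists c B : R, 0 < c /\ forall x, B < sqn x -> c <= W x.

(** By compactness on a large ball, and by the behaviour at infinity outside
it. *)
Lemma W_gap (r : R) : 0 < r -> exists2 w, 0 < w &
  forall x, r <= sqn (x - a) -> r <= sqn (x - b) -> w <= W x.
Proof.
move=> r0; have [c [B [c0 hB]]] := W_far.
set K := [set x : 'rV[R]_N | sqn (x - 0) <= B] `&`
  ([set x | r <= sqn (x - a)] `&` [set x | r <= sqn (x - b)]).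
have cK : compact K.
  apply: (subclosed_compact _ (@compact_sqn_le R N 0 B)); last by move=> x [].
  apply: closedI; first exact: closed_sqn_le.
  by apply: closedI; exact: closed_sqn_ge.
have inK x : ~ K x -> r <= sqn (x - a) -> r <= sqn (x - b) -> c <= W x.
  move=> nK xa xb; apply: hB; rewrite ltNge; apply/negP => xB.
  by apply: nK; split => //; rewrite /= subr0.
have [K0|] := pselect (K !=set0); last first.
  move=> K0; exists c => // x; apply: inK => Kx; apply: K0; by exists x.
have [x0 /set_mem[_ [xa xb]] hmin] := compact_EVT_min K0 cK
  (continuous_subspaceT W_cont).
have W0 : 0 < W x0.
  rewrite lt_neqAle W_ge0 andbT eq_sym; apply/eqP => /W_zero[] e.
    by move: xa; rewrite e /= subrr sqn0 leNgt r0.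
  by move: xb; rewrite e /= subrr sqn0 leNgt r0.
exists (Num.min c (W x0)); first by rewrite lt_min c0 W0.
move=> x rxa rxb; rewrite ge_min; have [Kx|nK] := pselect (K x).
  by rewrite hmin ?orbT ?inE.
by rewrite inK.
Qed.

Lemma energy_leP M u q p : profile W setT u q p -> energy_le M q p ->
  [/\ 0 <= M, forall s t, s <= t -> q t - q s <= M &
      forall s t, s <= t -> p t - p s <= M].
Proof.
move=> [k h] E; split=> [|s t st|s t st]; first by have := E 0 0 (lexx 0); lra.
  by have := E s t st; have := potential_mono W_ge0 h I I st; lra.
by have := E s t st; have := kinetic_mono k I I st; lra.
Qed.

(** A curve of finite energy that is far from both wells stays so for a while,
by its Hölder bound, and pays for it. *)
Lemma escape_cost (M r : R) : 0 < r -> exists L k, [/\ 0 < L, 0 < k &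
  forall u q p, profile W setT u q p -> energy_le M q p -> forall t,
    r <= sqn (u t - a) -> r <= sqn (u t - b) -> k <= p (t + L) - p t].
Proof.
move=> r0; have r40 : 0 < r / 4 by rewrite divr_gt0.
have [w w0 hw] := W_gap r40.
have M1 : 0 < 8 * (`|M| + 1) by rewrite mulr_gt0// ltr_wpDl.
exists (r / (8 * (`|M| + 1))), (w * (r / (8 * (`|M| + 1)))).
split; [by rewrite divr_gt0|by rewrite mulr_gt0// divr_gt0|].
move=> u q p P E t ta tb.
have [M0 Eq _] := energy_leP P E.
set L := r / _; have L0 : 0 < L by rewrite divr_gt0.
have LM : L * (8 * (M + 1)) = r.
  by rewrite /L ger0_norm// -mulrA mulVf ?mulr1// gt_eqF//; lra.
have far z s : t <= s <= t + L -> r <= sqn (u t - z) -> r / 4 <= sqn (u s - z).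
  move=> /andP[ts st] hz.
  have := sqnD_le2 (u s - z) (u t - u s).
  have -> : u s - z + (u t - u s) = u t - z by rewrite [LHS]addrC addrA subrK.
  have := kinetic_holder P.1 Eq s t; rewrite distrC ger0_norm ?subr_ge0//.
  have : 2 * M * (s - t) <= 2 * M * L by apply: ler_wpM2l; lra.
  lra.
have := P.2 t (t + L) w I I; rewrite lerDl (ltW L0) => /(_ isT) h.
have -> : w * L = w * (t + L - t) by ring.
by apply: h => s ts; apply: hw; exact: far.
Qed.

(** Far out, [W >= c]: a curve at a large distance would stay out for the time
[L = (M + 1) / c] and spend there more than its energy [M]. *)
Lemma energy_bounded (M : R) : exists B, forall u q p,
  profile W setT u q p -> energy_le M q p -> forall t, sqn (u t) <= B.
Proof.
have [c [B [c0 hB]]] := W_far.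
set L := (`|M| + 1) / c.
have L0 : 0 < L by rewrite divr_gt0// ltr_wpDl.
exists (2 * B + 4 * `|M| * L) => u q p P E t.
have [M0 Eq Ep] := energy_leP P E.
rewrite leNgt; apply/negP => tB.
have := P.2 t (t + L) c I I; rewrite lerDl (ltW L0) => /(_ isT) h.
have : c * (t + L - t) <= p (t + L) - p t.
  apply: h => s /andP[ts st]; apply: hB.
  have := sqnD_le2 (u s) (u t - u s); rewrite [u s + _]addrC subrK.
  have := kinetic_holder P.1 Eq s t; rewrite distrC ger0_norm ?subr_ge0//.
  have : 2 * M * (s - t) <= 2 * M * L by apply: ler_wpM2l; lra.
  by move: tB; rewrite ger0_norm//; lra.
have := Ep t (t + L); rewrite lerDl (ltW L0) => /(_ isT) h2.
have -> : c * (t + L - t) = `|M| + 1 by rewrite /L; field; rewrite gt_eqF.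
by rewrite ger0_norm//; lra.
Qed.

(** Time reversal, which reduces [-oo] to [+oo]. *)
Lemma profile_rev u q p : profile W setT u q p ->
  profile W setT (fun t => u (- t)) (fun t => - q (- t)) (fun t => - p (- t)).
Proof.
move=> [k h]; split=> [s t _ _ st|s t w _ _ st hw].
  have := k (- t) (- s) I I; rewrite lerN2 => /(_ st).
  by rewrite sqnB; congr (_ <= _); ring.
have := h (- t) (- s) w I I; rewrite lerN2 => /(_ st) {}h.
have -> : t - s = - s - - t by ring.
have -> : - p (- t) - - p (- s) = p (- s) - p (- t) by ring.
apply: h => r /andP[r1 r2]; have := hw (- r); rewrite opprK; apply.
by rewrite lerNr r2 lerNl r1.
Qed.

Lemma energy_le_rev (M : R) q p : energy_le M q p ->
  energy_le M (fun t => - q (- t)) (fun t => - p (- t)).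
Proof.
by move=> E s t st; have := E (- t) (- s); rewrite lerN2 => /(_ st); lra.
Qed.

(** Each visit away from the wells costs the amount [k] of [escape_cost], so
there are finitely many of them. *)
Lemma near_wells_y (M r : R) u q p : 0 < r -> profile W setT u q p ->
  energy_le M q p ->
  exists T, forall t, T <= t -> sqn (u t - a) < r \/ sqn (u t - b) < r.
Proof.
move=> r0 P E; have [L [k [L0 k0 hk]]] := escape_cost M r0.
have [_ _ Ep] := energy_leP P E.
apply: contrapT => /forallNP nT.
have bad T : exists2 t, T <= t & r <= sqn (u t - a) /\ r <= sqn (u t - b).
  have := nT T => /existsNP[t /not_implyP[Tt /not_orP[ta tb]]].
  exists t => //; split; rewrite leNgt; exact/negP.
have inc n : exists2 t, 0 <= t & n%:R * k <= p t - p 0.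
  elim: n => [|n [t t0 ht]]; first by exists 0; rewrite // mul0r subrr.
  have [t' tt' [ta tb]] := bad t; exists (t' + L).
    by rewrite addr_ge0// ?(ltW L0)// (le_trans t0).
  have := hk _ _ _ P E t' ta tb; have := potential_mono W_ge0 P.2 I I tt'.
  by rewrite -natr1 mulrDl mul1r; lra.
have [n hn] : exists n : nat, M / k < n%:R.
  exists (Num.truncn `|M / k|).+1; exact: le_lt_trans (ler_norm _) (truncnS_gt _).
have [t t0 ht] := inc n; have := Ep 0 t t0.
by move: hn; rewrite ltr_pdivrMr//; lra.
Qed.

Lemma near_wells_Ny (M r : R) u q p : 0 < r -> profile W setT u q p ->
  energy_le M q p ->
  exists T, forall t, t <= T -> sqn (u t - a) < r \/ sqn (u t - b) < r.
Proof.
move=> r0 P E.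
have [T hT] := near_wells_y r0 (profile_rev P) (energy_le_rev E).
by exists (- T) => t; rewrite -[t in u t]opprK => tT; apply: hT; rewrite lerNr.
Qed.

End Wells.

(** * Existence of a minimizer *)

Section Existence.
Context {R : realType} {N : nat} {W : 'rV[R]_N -> R} {a b : 'rV[R]_N}.
Hypothesis W_ge0 : forall x, 0 <= W x.
Hypothesis W_cont : continuous W.
Hypothesis W_zero : forall x, W x = 0 <-> x = a \/ x = b.
Hypothesis W_far : exists c B : R, 0 < c /\ forall x, B < sqn x -> c <= W x.
Variables (C dl : R).
Hypotheses (C_gt0 : 0 < C) (dl_gt0 : 0 < dl).
Hypothesis W_quad : forall z, W z = 0 -> forall x, sqn (x - z) < dl ->
  W x <= C * sqn (x - z).
Hypothesis ab : a <> b.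

Let Wa : W a = 0. Proof. by apply/W_zero; left. Qed.
Let Wb : W b = 0. Proof. by apply/W_zero; right. Qed.

Lemma wells_dist_gt0 : 0 < sqn (b - a).
Proof.
rewrite ltNge; apply/negP => /sqn_eq0/eqP; rewrite subr_eq0 => /eqP e.
exact: ab.
Qed.

Lemma wells_apart r x : 4 * r <= sqn (b - a) -> sqn (x - a) <= r ->
  r <= sqn (x - b).
Proof.
move=> h xa; have := sqnD_le2 (x - a) (b - x).
rewrite addrC subrKA (sqnB b x); lra.
Qed.

(** The translation that fixes the time origin: [0] becomes the last time at which
the curve is in the ball of squared radius [r] around [a]. *)
Lemma last_exit (M r : R) u q p : 0 < r -> 4 * r <= sqn (b - a) ->
  admissible W a b M u q p -> exists u' q' p',
  [/\ admissible W a b M u' q' p', sqn (u' 0 - a) = r,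
      forall t, 0 <= t -> r <= sqn (u' t - a) & q' 0 = 0 /\ p' 0 = 0].
Proof.
move=> r0 rab [P ua ub E]; have [M0 Eq _] := energy_leP W_ge0 P E.
have fc t : sqn (u s - a) @[s --> t] --> sqn (u t - a).
  apply: cvg_sqn; apply: cvgB; last exact: cvg_cst.
  by apply/sqn_cvgP => e e0; exact: holder_cvg e0 (kinetic_holder P.1 Eq).
set S := [set t | sqn (u t - a) <= r].
have S0 : S !=set0.
  by have [T hT] := ua _ r0; exists T; rewrite /S/= ltW// hT.
have [T hT] : exists T, forall t, T <= t -> r < sqn (u t - a).
  have [T hT] := ub _ r0; exists T => t /hT h; rewrite ltNge; apply/negP.
  by move=> /(wells_apart rab); rewrite leNgt h.
have ubS : ubound S T.
  move=> t /= St; rewrite leNgt; apply/negP => /ltW /hT; rewrite ltNge.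
  by rewrite St.
have hS : has_sup S by split => //; exists T.
set t0 := sup S.
have after t : t0 < t -> r < sqn (u t - a).
  move=> tt; rewrite ltNge; apply/negP => St.
  by have := sup_upper_bound hS St; rewrite leNgt tt.
have f0 : sqn (u t0 - a) = r.
  apply/le_anti/andP; split; rewrite leNgt; apply/negP => h.
    have /nbhs_ballP[d /= d0 hd] : \forall s \near t0, r < sqn (u s - a).
      exact: (cvgr_gt _ (fc t0)).
    have [s Ss ds] := sup_adherent d0 hS.
    have := hd s; rewrite -ball_normE/= => h1.
    have := sup_upper_bound hS Ss => h2.
    have : r < sqn (u s - a).
      by apply: h1; rewrite ger0_norm ?subr_ge0//; move: ds; rewrite -/t0; lra.
    by rewrite ltNge Ss.
  have /nbhs_ballP[d /= d0 hd] : \forall s \near t0, sqn (u s - a) < r.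
    exact: (cvgr_lt _ (fc t0)).
  have : sqn (u (t0 + d / 2) - a) < r.
    apply: hd; rewrite -ball_normE/= opprD addrA subrr add0r normrN.
    by rewrite ger0_norm; lra.
  by rewrite ltNge ltW// after//; lra.
exists (fun t => u (t + t0)), (fun t => q (t + t0) + (- q t0)),
  (fun t => p (t + t0) + (- p t0)).
split; rewrite ?add0r//.
- split.
  + exact: (profile_addc _ _ (profile_shift t0 P)).
  + move=> e e0; have [T1 h] := ua _ e0; exists (T1 - t0) => t tT.
    by apply: h; lra.
  + move=> e e0; have [T1 h] := ub _ e0; exists (T1 - t0) => t tT.
    by apply: h; lra.
  + move=> s t st; have := E (s + t0) (t + t0); rewrite lerD2r => /(_ st).
    lra.
- move=> t; rewrite le_eqVlt => /predU1P[<-|t_gt0]; rewrite ?add0r ?f0//.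
  by apply/ltW/after; lra.
- by rewrite !subrr.
Qed.

(** The straight segment, run through in unit time between two rests. *)
Lemma exists_admissible : exists M u q p, admissible W a b M u q p.
Proof.
have [B hB] : exists B, forall t, 0 <= t <= 1 -> W (a + t *: (b - a)) <= B.
  have := @EVT_max R (fun t => W (a + t *: (b - a))) 0 1 ler01.
  case=> [|c _ hc]; last first.
    by exists (W (a + c *: (b - a))) => t t01; apply: hc; rewrite in_itv.
  apply: continuous_subspaceT => t; apply: continuous_comp; last exact: W_cont.
  apply: cvgD; first exact: cvg_cst.
  by apply: cvgZl; exact: cvg_id.
have Ps := profile_segment hB.
have Pa := profile_cst setT Wa; have Pb := profile_cst setT Wb.
have ta : tends_Ny (fun=> a) a.
  by move=> e e0; exists 0 => t _; rewrite subrr sqn0.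
have tb : tends_y (fun=> b) b.
  by move=> e e0; exists 0 => t _; rewrite subrr sqn0.
have := @splice R N W W_ge0 a b 0 0 0 1 0 _ _ _ _ _ _ _ _ _ Pa ta Pb tb Ps ler01.
rewrite scale0r addr0 scale1r addrC subrK => /(_ erefl erefl) [|x [y [z h]]].
  by move=> s t _ _; rewrite !addr0 !subrr addr0.
by eexists; exists x, y, z; exact: h.
Qed.

(** Cutting: a curve that comes close to [b] before the energy [k] is spent can
be sent straight to [b], for a small cost. *)
Lemma shortcut (M k : R) u q p T L e :
  admissible W a b M u q p -> T <= 0 -> 0 <= L -> k <= p L - p 0 ->
  e <= dl -> sqn (u T - b) < e ->
  exists x y z, admissible W a b (M - k + (2^-1 + C) * e) x y z.
Proof.
move=> [P ua ub E] T0 L0 hk edl he.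
have hB t : 0 <= t <= 1 -> W (u T + t *: (b - u T)) <= C * e.
  move=> /andP[t0 t1].
  have eq1 : u T + t *: (b - u T) - b = (1 - t) *: (u T - b).
    rewrite scalerBl scale1r -[b - u T]opprB scalerN.
    by rewrite [LHS]addrAC.
  have le1 : sqn (u T + t *: (b - u T) - b) <= sqn (u T - b).
    rewrite eq1 sqnZ ler_piMl ?sqn_ge0//; nra.
  apply: (le_trans (W_quad Wb _)).
    by rewrite (le_lt_trans le1)// (lt_le_trans he).
  by rewrite ler_pM2l// (le_trans le1)// ltW.
have Ps := profile_segment hB.
have Pb := profile_cst setT Wb.
have tb : tends_y (fun=> b) b.
  by move=> d d0; exists 0 => t _; rewrite subrr sqn0.
have := @splice R N W W_ge0 a b T 0 0 1 (M - k) _ _ _ _ _ _ _ _ _ P ua Pb tb Ps ler01.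
rewrite scale0r addr0 scale1r addrC subrK => /(_ erefl erefl) [|x [y [z h]]].
  move=> s t sT _.
  have := E s L; have := kinetic_mono P.1 I I (le_trans T0 L0).
  have := potential_mono W_ge0 P.2 I I T0.
  by move=> h1 h2 /(_ (le_trans sT (le_trans T0 L0))); lra.
exists x, y, z; case: h => h1 h2 h3 h4; split => // s t st.
apply: (le_trans (h4 s t st)); rewrite (sqnB b).
by lra.
Qed.

(** The limit of a normalized minimizing sequence.  After time [0] it stays away
from [a], so it tends to [b].  Before time [0] it stays away from [b], otherwise
[shortcut] applied to the sequence would save a fixed amount of energy; so it
comes from [a]. *)
Theorem exists_minimizer : exists m u q p, admissible W a b m u q p /\
  forall M u' q' p', admissible W a b M u' q' p' -> m <= M.
Proof.
set A := [set M | exists u q p, admissible W a b M u q p].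
have A0 : A !=set0.
  by have [M [u [q [p h]]]] := exists_admissible; exists M, u, q, p.
have lbA : lbound A 0.
  move=> M [u [q [p [_ _ _ E]]]]; have := E 0 0 (lexx _); lra.
have iA : has_inf A by split => //; exists 0.
set m := inf A.
have mle M u q p : admissible W a b M u q p -> m <= M.
  by move=> h; apply: ge_inf => //; [exists 0|exists u, q, p].
(* the radius makes the ball around [a] stay away from [b] *)
set r := sqn (b - a) / 4.
have r0 : 0 < r by rewrite divr_gt0// wells_dist_gt0.
have rab : 4 * r <= sqn (b - a) by rewrite /r; lra.
have /choice[X hX] : forall n : nat,
    exists X : (R -> 'rV[R]_N) * (R -> R) * (R -> R),
    [/\ admissible W a b (m + n.+1%:R^-1) X.1.1 X.1.2 X.2,
     sqn (X.1.1 0 - a) = r, forall t, 0 <= t -> r <= sqn (X.1.1 t - a) &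
     X.1.2 0 = 0 /\ X.2 0 = 0].
  move=> n; have n0 : 0 < n.+1%:R^-1 :> R by rewrite invr_gt0 ltr0n.
  have [M [u [q [p [P ua ub E]]]] Mm] := inf_adherent n0 iA.
  have : admissible W a b (m + n.+1%:R^-1) u q p.
    by split => // s t st; rewrite (le_trans (E s t st))// ltW.
  by move=> /(last_exit r0 rab)[u' [q' [p' h]]]; exists (u', q', p').
set u := fun n => (X n).1.1; set q := fun n => (X n).1.2.
set p := fun n => (X n).2.
have P n : profile W setT (u n) (q n) (p n) by case: (hX n) => [[]].
have E n : energy_le (m + n.+1%:R^-1) (q n) (p n) by case: (hX n) => [[]].
have E1 n : energy_le (m + 1) (q n) (p n).
  move=> s t st; rewrite (le_trans (E n s t st))// lerD2l invf_le1 ?ltr0n//.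
  by rewrite ler1n.
have [B hB] := @energy_bounded _ _ _ W_ge0 W_far (m + 1).
have uB n t : sqn (u n t - 0) <= B.
  by rewrite subr0; exact: (hB _ _ _ (P n) (E1 n)).
have monoq n s t : s <= t -> q n s <= q n t.
  by move=> st; exact: (kinetic_mono (P n).1).
have monop n s t : s <= t -> p n s <= p n t.
  by move=> st; exact: (potential_mono W_ge0 (P n).2).
have qB n t : q n t \in `[- (m + 1), m + 1].
  have [_ h _] := energy_leP W_ge0 (P n) (E1 n).
  have [_ _ _ [q00 _]] := hX n.
  rewrite in_itv/=; have [t0|/ltW t0] := leP 0 t.
    by have := h _ _ t0; have := monoq n _ _ t0; rewrite /q q00; lra.
  by have := h _ _ t0; have := monoq n _ _ t0; rewrite /q q00; lra.
have pB n t : p n t \in `[- (m + 1), m + 1].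
  have [_ _ h] := energy_leP W_ge0 (P n) (E1 n).
  have [_ _ _ [_ p00]] := hX n.
  rewrite in_itv/=; have [t0|/ltW t0] := leP 0 t.
    by have := h _ _ t0; have := monop n _ _ t0; rewrite /p p00; lra.
  by have := h _ _ t0; have := monop n _ _ t0; rewrite /p p00; lra.
have [G [GU ooG]] := @ultraFilterLemma nat \oo _.
have GP : ProperFilter G := ultra_proper.
have /choice[v hv] : forall t : R, exists l : 'rV[R]_N, u n t @[n --> G] --> l.
  move=> t; have [l _ hl] :=
    ultra_compact_cvg GU (@compact_sqn_le R N 0 B) (uB ^~ t).
  by exists l.
have /choice[vq hq] : forall t : R, exists l : R, q n t @[n --> G] --> l.
  move=> t; have [l _ hl] :=
    ultra_compact_cvg GU (@segment_compact R (- (m + 1)) (m + 1)) (qB ^~ t).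
  by exists l.
have /choice[vp hp] : forall t : R, exists l : R, p n t @[n --> G] --> l.
  move=> t; have [l _ hl] :=
    ultra_compact_cvg GU (@segment_compact R (- (m + 1)) (m + 1)) (pB ^~ t).
  by exists l.
have Pv : profile W setT v vq vp.
  apply: (@profile_limit _ _ W G (m + 1) u q p) => // n s t st.
  by have [_ h _] := energy_leP W_ge0 (P n) (E1 n); exact: h.
have Ev : energy_le m vq vp.
  move=> s t st.
  have c1 : (q n t + p n t) - (q n s + p n s) @[n --> G] -->
      (vq t + vp t) - (vq s + vp s).
    by apply: cvgB; apply: cvgD.
  have c2 : m + n.+1%:R^-1 @[n --> G] --> m.
    have c3 : (fun n : nat => m + n.+1%:R^-1 : R) @ \oo --> m.
      rewrite -[X in _ --> X]addr0; apply: cvgD; first exact: cvg_cst.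
      exact: cvg_harmonic.
    by move=> A' /c3 /ooG.
  apply: (ler_cvg_to c1 c2); apply: nearW => n; exact: E.
have v_far t : 0 <= t -> r <= sqn (v t - a).
  move=> t0; have c1 : sqn (u n t - a) @[n --> G] --> sqn (v t - a).
    by apply: cvg_sqn; apply: cvgB; [exact: hv|exact: cvg_cst].
  apply: (cvgr_to_ge c1); apply: nearW => n; case: (hX n) => _ _ h _; exact: h.
exists m, v, vq, vp; split; last first.
  by move=> M u' q' p'; exact: mle.
split => //; last first.
  move=> e e0; have d0 : 0 < Num.min e r by rewrite lt_min e0 r0.
  have [T hT] := near_wells_y W_ge0 W_cont W_zero W_far d0 Pv Ev.
  exists (Num.max T 0) => t; rewrite ge_max => /andP[Tt t0].
  case: (hT t Tt); rewrite lt_min => /andP[h1 h2] //.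
  by move: (v_far t t0); rewrite leNgt h2.
have [L [k [L0 k0 hk]]] := escape_cost W_ge0 W_cont W_zero W_far (m + 1) r0.
have spend n : k <= p n L - p n 0.
  have [_ h0 h _] := hX n; rewrite -[L]add0r.
  apply: (hk _ _ _ (P n) (E1 n)); first by rewrite h0.
  by apply: wells_apart; rewrite // h0.
(* a detour to [b] from within [e1] costs at most [k / 2] *)
set e1 := Num.min dl (k / 2 / (2^-1 + C)).
have C1 : 0 < 2^-1 + C by rewrite addr_gt0.
have e10 : 0 < e1 by rewrite lt_min dl_gt0/= !divr_gt0.
have v_farb t : t <= 0 -> e1 <= sqn (v t - b).
  move=> t0; rewrite leNgt; apply/negP => vt.
  have c1 : sqn (u n t - b) @[n --> G] --> sqn (v t - b).
    by apply: cvg_sqn; apply: cvgB; [exact: hv|exact: cvg_cst].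
  have n1 : \near G, sqn (u G t - b) < e1 by exact: (cvgr_lt _ c1).
  have n2 : \forall n \near G, n.+1%:R^-1 < k / 2.
    apply: ooG; apply: (cvgr_lt _ (@cvg_harmonic R)).
    by rewrite divr_gt0.
  have [n [un kn]] := filter_ex (filterI n1 n2).
  have e1dl : e1 <= dl by rewrite ge_min lexx.
  have [An _ _ _] := hX n.
  have [x [y [z /mle]]] := shortcut An t0 (ltW L0) (spend n) e1dl un.
  have : (2^-1 + C) * e1 <= k / 2.
    by rewrite mulrC -ler_pdivlMr// ge_min lexx orbT.
  have ar (m1 i k1 E0 : R) : i < k1 / 2 -> E0 <= k1 / 2 ->
    m1 <= m1 + i - k1 + E0 -> False by move=> *; lra.
  move=> h1 h2; exact: (ar _ _ _ _ kn h1 h2).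
move=> e e0; have d0 : 0 < Num.min e e1 by rewrite lt_min e0 e10.
have [T hT] := near_wells_Ny W_ge0 W_cont W_zero W_far d0 Pv Ev.
exists (Num.min T 0) => t; rewrite le_min => /andP[Tt t0].
case: (hT t Tt); rewrite lt_min => /andP[h1 h2] //.
by move: (v_farb t t0); rewrite leNgt h2.
Qed.

End Existence.

(** * Variations of a curve *)

(** Cutting [[s, t]] into small equal pieces makes the total defect as small as
wanted. *)
Lemma almost_nondecreasing (R : realType) (f : R -> R) (s t : R) : s <= t ->
  (forall e, 0 < e -> exists2 d, 0 < d & forall x y, s <= x -> x <= y ->
    y <= t -> y - x < d -> - (e * (y - x)) <= f y - f x) ->
  f s <= f t.
Proof.
move=> st h; apply/ler_addgt0Pr => e e0.
have st1 : 0 < t - s + 1 by rewrite ltr_wpDl// subr_ge0.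
have e1 : 0 < e / (t - s + 1) by rewrite divr_gt0.
have ce : e / (t - s + 1) * (t - s) <= e.
  by rewrite mulrAC ler_pdivrMr// ler_pM2l// lerDl.
move: e1 ce; set c := e / _ => e1 ce; have [d d0 hd] := h _ e1.
set n := (Num.truncn ((t - s) / d)).+1.
have n0 : 0 < n%:R :> R by rewrite ltr0n.
have nd : (t - s) / n%:R < d.
  by rewrite ltr_pdivrMr// mulrC -ltr_pdivrMr// truncnS_gt.
set l := (t - s) / n%:R; have l0 : 0 <= l by rewrite divr_ge0 ?subr_ge0// ltW.
have nl : n%:R * l = t - s by rewrite /l mulrC divfK// gt_eqF.
have step k : (k <= n)%N -> - (c * (k%:R * l)) <= f (s + k%:R * l) - f s.
  elim: k => [_|k ih kn]; first by rewrite !mul0r mulr0 addr0 subrr oppr0.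
  have := ih (ltnW kn).
  have kl0 : 0 <= k%:R * l by rewrite mulr_ge0.
  have k1 : k.+1%:R * l = k%:R * l + l by rewrite -natr1 mulrDl mul1r.
  have : k.+1%:R * l <= t - s.
    by rewrite -nl ler_wpM2r// ler_nat.
  have := hd (s + k%:R * l) (s + k.+1%:R * l).
  rewrite k1; set x := k%:R * l in kl0 *.
  have -> : s + (x + l) - (s + x) = l by ring.
  move=> h1 h2 h3; have {}h1 := h1 _ _ _ nd.
  have : - (c * l) <= f (s + (x + l)) - f (s + x) by apply: h1; lra.
  by rewrite mulrDr; lra.
have := step n (leqnn _); rewrite nl => hn.
have st' : s + (t - s) = t by ring.
rewrite st' in hn.
move: hn ce; set cc := _ * _; lra.
Qed.

Section Variation.
Context {R : realType} {N : nat} {W : 'rV[R]_N -> R}.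

(** If [W] grows by at most an affine function of time, the integral of that
function can be added to the profile. *)
Lemma potential_profile_affine (c d A B : R) (u v : R -> 'rV[R]_N) p :
  potential_profile W `[c, d] u p ->
  (forall r, c <= r <= d -> W (v r) <= W (u r) + A * r + B) ->
  potential_profile W `[c, d] v (fun r => p r + (A / 2 * r ^+ 2 + B * r)).
Proof.
move=> h hv s t w; rewrite /= !in_itv/= => /andP[cs sd] /andP[ct td] st hw.
suff : p s + (A / 2 * s ^+ 2 + B * s) - w * s <=
       p t + (A / 2 * t ^+ 2 + B * t) - w * t by lra.
pose f r := p r + (A / 2 * r ^+ 2 + B * r) - w * r.
apply: (@almost_nondecreasing R f) => // e e0.
have A1 : 0 < `|A| * 2 + 1 by rewrite ltr_wpDl// mulr_ge0.
exists (e / (`|A| * 2 + 1)); first by rewrite divr_gt0.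
move=> x y sx xy yt; rewrite ltr_pdivlMr// => yx.
have xy0 : 0 <= y - x by rewrite subr_ge0.
have : (w - B - A * x - `|A| * (y - x)) * (y - x) <= p y - p x.
  apply: h => //; rewrite /= ?in_itv/=; [lra|lra|].
  move=> r /andP[xr ry].
  have := hw r; rewrite (le_trans sx xr) (le_trans ry yt) => /(_ isT) hwr.
  have := hv r; rewrite (le_trans cs (le_trans sx xr)) (le_trans ry (le_trans yt td)).
  move=> /(_ isT) hvr.
  have : A * (r - x) <= `|A| * (y - x).
    apply: (@le_trans _ _ (`|A| * (r - x))).
      by apply: ler_wpM2r; [lra|exact: ler_norm].
    by apply: ler_wpM2l => //; lra.
  lra.
rewrite /f => h1.
have a1 : - `|A| <= A by rewrite lerNl -normrN ler_norm.
have : 0 <= (A + `|A|) * (y - x) ^+ 2 by rewrite mulr_ge0 ?sqr_ge0//; lra.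
have : `|A| * (y - x) * (y - x) * 2 <= e * (y - x) .
  by rewrite mulrAC; apply: ler_wpM2r => //; lra.
have : 0 <= `|A| * (y - x) ^+ 2 by rewrite mulr_ge0// sqr_ge0.
move: h1; set Q := `|A|; set P1 := p y; set P2 := p x; nra.
Qed.

Lemma dotp_delta (x : 'rV[R]_N) i : dotp x (delta_mx 0 i) = x 0 i.
Proof.
rewrite /dotp (bigD1 i)//= mxE !eqxx mulr1 big1 ?addr0// => j ji.
by rewrite mxE (negbTE ji) andbF mulr0.
Qed.

Lemma sqn_delta (i : 'I_N) : sqn (delta_mx 0 i : 'rV[R]_N) = 1.
Proof.
rewrite /sqn (bigD1 i)//= mxE !eqxx expr1n big1 ?addr0// => j ji.
by rewrite mxE (negbTE ji) andbF expr0n.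
Qed.

(** Adding an affine motion along a coordinate axis changes the kinetic energy by
an exactly additive amount: the cross term [al * (u t - u s)_i] telescopes. *)
Lemma kinetic_profile_affine I (al be : R) (u : R -> 'rV[R]_N) q i :
  kinetic_profile I u q ->
  kinetic_profile I (fun r => u r + (al * r + be) *: delta_mx 0 i)
    (fun r => q r + (al * u r 0 i + al ^+ 2 / 2 * r)).
Proof.
move=> k s t Is It st; have h := k s t Is It st.
have -> : u t + (al * t + be) *: delta_mx 0 i - (u s + (al * s + be) *: delta_mx 0 i)
    = (u t - u s) + (al * (t - s)) *: (delta_mx 0 i : 'rV[R]_N).
  rewrite opprD addrACA -scalerBl; congr (_ + _ *: _); ring.
rewrite sqnD sqnZ sqn_delta dotpC dotpZl dotpC dotp_delta !mxE.
have -> : 2 * (t - s) * (q t + (al * u t 0 i + al ^+ 2 / 2 * t) -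
    (q s + (al * u s 0 i + al ^+ 2 / 2 * s))) = 2 * (t - s) * (q t - q s) +
    2 * (al * (t - s) * (u t 0 i - u s 0 i)) + (al * (t - s)) ^+ 2 by field.
by rewrite mulr1 lerD2r lerD2r.
Qed.

End Variation.

Lemma is_derive_line (R : realType) (N : nat) (W : 'rV[R]_N -> R) x v (s : R) :
  derivable W (x + s *: v) v ->
  is_derive s 1 (fun r => W (x + r *: v)) ('D_v W (x + s *: v)).
Proof.
move=> dW.
have E : (fun h : R =>
     h^-1 *: (((fun r : R => W (x + r *: v)) \o shift s) (h *: 1)
     - W (x + s *: v))) =
   (fun h : R => h^-1 *: ((W \o shift (x + s *: v)) (h *: v) - W (x + s *: v))).
  apply/funext => h /=; congr (_ *: (W _ - _)).
  by rewrite [h *: 1]mulr1 scalerDl addrCA.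
by split; [move: dW; rewrite /derivable E|rewrite /derive E].
Qed.

(** Strict differentiability along an axis, by the mean value theorem and the
continuity of the gradient. *)
Lemma grad_increment (R : realType) (N : nat) (W : 'rV[R]_N -> R) x0 i :
  (\forall x \near x0, differentiable W x) -> {for x0, continuous (grad W)} ->
  forall e, 0 < e -> exists2 r, 0 < r & forall x s,
    sqn (x - x0) < r -> s ^+ 2 < r ->
    `|W (x + s *: delta_mx 0 i) - W x - s * grad W x0 0 i| <= e * `|s|.
Proof.
move=> dW cW e e0.
have /near_sqn[r1 r10 h1] := dW.
have cg : (fun x => grad W x 0 i) @ x0 --> grad W x0 0 i.
  exact: (continuous_cvg _ (@coord_continuous R 1 N 0 i (grad W x0)) cW).
have /cvgrPdist_lt/(_ e e0)/near_sqn[r2 r20 h2] := cg.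
set r := Num.min r1 r2 / 4.
have r0 : 0 < r by rewrite divr_gt0// lt_min r10 r20.
have r4 : 4 * r = Num.min r1 r2 by rewrite /r; field.
exists r => // x s hx hs.
set v : 'rV[R]_N := delta_mx 0 i.
have inball z : z ^+ 2 <= s ^+ 2 -> sqn (x + z *: v - x0) < Num.min r1 r2.
  move=> zs; rewrite addrAC (le_lt_trans (sqnD_le2 _ _))// sqnZ sqn_delta mulr1.
  by lra.
have dd z : z ^+ 2 <= s ^+ 2 ->
    is_derive z 1 (fun r => W (x + r *: v)) (grad W (x + z *: v) 0 i).
  move=> /inball; rewrite lt_min => /andP[/h1 h _].
  by rewrite mxE; apply: is_derive_line; exact: diff_derivable.
have ge z : z ^+ 2 <= s ^+ 2 -> `|grad W (x + z *: v) 0 i - grad W x0 0 i| <= e.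
  by move=> /inball; rewrite lt_min => /andP[_ /h2 /ltW]; rewrite distrC.
pose phi z := W (x + z *: v).
have mvt a b : a <= b -> (forall z, a <= z <= b -> z ^+ 2 <= s ^+ 2) ->
    `|phi b - phi a - (b - a) * grad W x0 0 i| <= e * (b - a).
  move=> ab hz.
  have [||c] := @MVT_segment R phi (fun z => grad W (x + z *: v) 0 i) a b ab.
  - by move=> z; rewrite in_itv/= => /andP[/ltW az /ltW zb]; apply/dd/hz/andP.
  - apply: derivable_within_continuous => z; rewrite in_itv/= => /hz /dd h.
    exact: ex_derive.
  rewrite in_itv/= => /hz/ge hc ->.
  rewrite mulrC -mulrBr normrM [`|b - a|]ger0_norm ?subr_ge0// mulrC.
  by rewrite ler_wpM2r// subr_ge0.
have phi0 : phi 0 = W x by rewrite /phi scale0r addr0.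
have [s0|/ltW s0] := leP 0 s.
  have h : forall z, 0 <= z <= s -> z ^+ 2 <= s ^+ 2.
    by move=> z /andP[z0 zs]; rewrite ler_pXn2r ?nnegrE.
  by rewrite (ger0_norm s0); have := mvt 0 s s0 h; rewrite subr0 phi0.
have h : forall z, s <= z <= 0 -> z ^+ 2 <= s ^+ 2.
  move=> z /andP[sz z0]; rewrite -sqrrN -[s ^+ 2]sqrrN.
  by rewrite ler_pXn2r ?nnegrE ?oppr_ge0// lerN2.
rewrite (ler0_norm s0) -normrN; have := mvt s 0 s0 h; rewrite sub0r phi0.
by congr (`|_| <= _); rewrite /phi; ring.
Qed.

(** * Properties of a minimizer *)

Section Minimizer.
Context {R : realType} {N : nat} {W : 'rV[R]_N -> R} {a b : 'rV[R]_N}.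
Hypothesis W_ge0 : forall x, 0 <= W x.
Hypothesis ab : a <> b.
Variables (C dl : R).
Hypotheses (C_gt0 : 0 < C) (dl_gt0 : 0 < dl).
Hypothesis W_quad : forall z, W z = 0 -> forall x, sqn (x - z) < dl ->
  W x <= C * sqn (x - z).
Hypothesis W_diff : forall x, W x <> 0 ->
  (\forall y \near x, differentiable W y) /\ {for x, continuous (grad W)}.
Variables (m : R) (u : R -> 'rV[R]_N) (q p : R -> R).
Hypothesis u_adm : admissible W a b m u q p.
Hypothesis u_min : forall M u' q' p', admissible W a b M u' q' p' -> m <= M.

Let kin : kinetic_profile setT u q. Proof. by case: u_adm => [[]]. Qed.
Let pot : potential_profile W setT u p. Proof. by case: u_adm => [[]]. Qed.

(** A piece of the minimizer is not more expensive than another path with the same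
ends, even one that takes another time. *)
Lemma local_minimality (a0 b0 c d : R) v q' p' : a0 <= b0 -> c <= d ->
  profile W `[c, d] v q' p' -> v c = u a0 -> v d = u b0 ->
  (q b0 + p b0) - (q a0 + p a0) <= (q' d + p' d) - (q' c + p' c).
Proof.
move=> ab0 cd Pv vc vd; have [P ua ub E] := u_adm.
have := splice W_ge0 (M := m - ((q b0 + p b0) - (q a0 + p a0)))
  P ua P ub Pv cd vc vd.
move=> /(_ _)[|x [y [z /u_min]]]; last by lra.
by move=> s t sa tb; have := E s t (le_trans sa (le_trans ab0 tb)); lra.
Qed.

(** Equipartition of energy, one half of it: running through a piece of the
curve at half speed halves its kinetic energy, which must not pay. *)
Lemma kinetic_le_potential s t B : s <= t ->
  (forall r, s <= r <= t -> W (u r) <= B) -> q t - q s <= 4 * B * (t - s).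
Proof.
move=> st hB.
pose g r := s + (r - s) / 2.
have Pv : profile W `[s, s + 2 * (t - s)] (fun r => u (g r))
    (fun r => q (g r) / 2) (fun r => B * r).
  split; last first.
    apply: potential_profile_le => r; rewrite /= in_itv/= => /andP[r1 r2].
    by apply: hB; rewrite /g; lra.
  move=> x y _ _ xy.
  have := kin I I (_ : g x <= g y); rewrite {1}/g {1}/g => /(_ ltac:(lra)) h.
  rewrite (le_trans h)//.
  have -> : g y - g x = (y - x) / 2 by rewrite /g; field.
  by have -> : 2 * ((y - x) / 2) * (q (g y) - q (g x)) =
    2 * (y - x) * (q (g y) / 2 - q (g x) / 2) by field.
have gs : g s = s by rewrite /g subrr mul0r addr0.
have gt : g (s + 2 * (t - s)) = t by rewrite /g; field.
have := local_minimality st _ Pv; rewrite gs gt => /(_ ltac:(lra) erefl erefl).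
have := potential_mono W_ge0 pot I I st.
by lra.
Qed.

Lemma u_holder s t : sqn (u t - u s) <= 2 * m * `|t - s|.
Proof.
have [P _ _ E] := u_adm; have [_ Eq _] := energy_leP W_ge0 P E.
exact: kinetic_holder kin Eq s t.
Qed.

Lemma m_ge0 : 0 <= m.
Proof. by have [P _ _ E] := u_adm; have [] := energy_leP W_ge0 P E. Qed.

(** By equipartition and the quadratic bound, the speed of the curve is at most
proportional to its distance to the well: it cannot reach it in finite time
unless it rests there. *)
Lemma rest_at_well : exists2 T, 0 < T & forall z t0, W z = 0 -> u t0 = z ->
  forall t, `|t - t0| <= T -> u t = z.
Proof.
have m0 := m_ge0; have C0 : 0 < C := C_gt0; have dl0 : 0 < dl := dl_gt0.
(* [T] bounds the excursion by [dl], and makes the estimate below contract *)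
pose T := Num.min 1 (Num.min (dl / (2 * m + 1) / 2) ((32 * C + 1)^-1)).
have m1 : 0 < 2 * m + 1 by lra.
have C1 : 0 < 32 * C + 1 by have := C_gt0; lra.
have T0 : 0 < T by rewrite !lt_min ltr01/= invr_gt0 C1 andbT !divr_gt0.
have T1 : T <= 1 by rewrite ge_min lexx.
have T2 : T * (2 * m + 1) <= dl / 2.
  rewrite -ler_pdivlMr// mulrAC.
  apply: (@le_trans _ _ (Num.min (dl / (2 * m + 1) / 2) ((32 * C + 1)^-1))).
    by rewrite /T ge_min lexx orbT.
  by rewrite ge_min lexx.
have T3 : T * (32 * C + 1) <= 1.
  rewrite -ler_pdivlMr// mul1r.
  apply: (@le_trans _ _ (Num.min (dl / (2 * m + 1) / 2) ((32 * C + 1)^-1))).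
    by rewrite /T ge_min lexx orbT.
  by rewrite ge_min lexx orbT.
exists T => // z t0 Wz uz.
have near_z t : `|t - t0| <= T -> sqn (u t - z) < dl.
  move=> tT; rewrite -uz (le_lt_trans (u_holder _ _))//.
  have : 2 * m * `|t - t0| <= 2 * m * T by apply: ler_wpM2l => //; lra.
  by lra.
have pair s t S : 0 <= S -> s <= t -> `|s - t0| <= T -> `|t - t0| <= T ->
    (forall r, `|r - t0| <= T -> sqn (u r - z) <= S) -> s = t0 \/ t = t0 ->
    sqn (u t - u s) <= S / 2.
  move=> S0 st sT tT hS st0.
  have hq : q t - q s <= 4 * (C * S) * (t - s).
    apply: kinetic_le_potential => // r rst.
    have rT : `|r - t0| <= T.
      move: rst sT tT; rewrite !ler_norml => /andP[? ?] /andP[? ?] /andP[? ?].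
      by apply/andP; split; lra.
    by rewrite (le_trans (W_quad Wz (near_z _ rT)))// ler_pM2l// hS.
  have tsT : t - s <= T.
    move: sT tT; rewrite !ler_norml => /andP[? ?] /andP[? ?].
    by case: st0 => e; rewrite ?e in st *; lra.
  apply: (le_trans (kin I I st)).
  have ts0 : 0 <= t - s by rewrite subr_ge0.
  apply: (@le_trans _ _ (2 * (t - s) * (4 * (C * S) * (t - s)))).
    by apply: ler_wpM2l => //; rewrite mulr_ge0.
  have CS : 0 <= C * S by rewrite mulr_ge0// ltW.
  apply: (@le_trans _ _ (2 * T * (4 * (C * S) * T))).
    apply: ler_pM.
    - by rewrite mulr_ge0.
    - by rewrite mulr_ge0// mulr_ge0.
    - by rewrite ler_pM2l.
    - by apply: ler_wpM2l => //; rewrite mulr_ge0.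
  have -> : 2 * T * (4 * (C * S) * T) = (8 * C * T) * T * S by ring.
  rewrite mulrC ler_wpM2l//.
  have CT0 : 0 <= 8 * C * T by rewrite !mulr_ge0// ltW.
  have : 8 * C * T <= 4^-1 by nra.
  move=> h8; rewrite (le_trans (ler_pM CT0 (ltW T0) h8 T1))// mulr1.
  by rewrite lef_pV2 ?posrE// ler_nat.
have contr n t : `|t - t0| <= T -> sqn (u t - z) <= dl / 2 ^+ n.
  elim: n t => [|n ih] t tT; first by rewrite expr0 divr1 ltW// near_z.
  have S0 : 0 <= dl / 2 ^+ n by rewrite divr_ge0 ?exprn_ge0// ltW.
  have t0T : `|t0 - t0| <= T by rewrite subrr normr0 ltW.
  rewrite exprS invfM mulrCA mulrC -uz.
  have [tt|/ltW tt] := leP t0 t.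
    by apply: pair => //; left.
  by rewrite sqnB; apply: pair => //; right.
move=> t tT; apply/eqP; rewrite -subr_eq0; apply/eqP/sqn_eq0.
rewrite leNgt; apply/negP => h0.
have [n hn] : exists n : nat, dl / sqn (u t - z) < n%:R.
  by exists (Num.truncn (dl / sqn (u t - z))).+1; exact: truncnS_gt.
have := contr n t tT; rewrite ler_pdivlMr ?exprn_gt0// leNgt => /negP; apply.
rewrite mulrC -ltr_pdivrMr// (lt_trans hn)// -natrX ltr_nat.
exact: ltn_expl.
Qed.

(** A rest at a well would extend to all times, whereas the two limits differ. *)
Lemma avoids_wells t : W (u t) <> 0.
Proof.
move=> Wt; have [T T0 h] := rest_at_well.
have rest n s : `|s - t| <= n%:R * T -> u s = u t.
  elim: n s => [|n ih] s; first by rewrite mul0r normr_le0 subr_eq0 => /eqP ->.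
  rewrite -natr1 mulrDl mul1r => hs.
  have n0 : 0 <= n%:R * T by rewrite mulr_ge0// ltW.
  have [st|/ltW st] := leP t s.
    have [sn|sn] := leP s (t + n%:R * T).
      by apply: ih; rewrite ger0_norm ?subr_ge0//; lra.
    apply: (h _ (t + n%:R * T)) => //; first by apply: ih; rewrite addrC addKr ger0_norm.
    by move: hs; rewrite !ger0_norm; lra.
  have [sn|sn] := leP (t - n%:R * T) s.
    by apply: ih; rewrite ler0_norm ?subr_le0//; lra.
  apply: (h _ (t - n%:R * T)) => //.
    by apply: ih; rewrite addrC addKr normrN ger0_norm.
  by move: hs; rewrite !ler0_norm; lra.
have cst s : u s = u t.
  have [n hn] : exists n : nat, `|s - t| / T < n%:R.
    by exists (Num.truncn (`|s - t| / T)).+1; exact: truncnS_gt.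
  by apply: (rest n); move: hn; rewrite ltr_pdivrMr// => /ltW.
have [_ ua ub _] := u_adm.
apply: ab; transitivity (u t).
  apply/eqP; rewrite eq_sym -subr_eq0; apply/eqP/sqn_eq0.
  apply/ler_addgt0Pr => e e0; rewrite add0r; have [S hS] := ua e e0.
  by have := hS S (lexx _); rewrite cst => /ltW.
apply/eqP; rewrite -subr_eq0; apply/eqP/sqn_eq0.
apply/ler_addgt0Pr => e e0; rewrite add0r; have [S hS] := ub e e0.
by have := hS S (lexx _); rewrite cst => /ltW.
Qed.

(** Testing minimality with the tent of height [e] over [[t - h, t + h]]. *)
Lemma tent_variation t i (h e g : R) : 0 < h ->
  (forall r x, `|r - t| <= h -> 0 <= x <= 1 ->
    W (u r + (x * e) *: delta_mx 0 i) <= W (u r) + g * (x * e)) ->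
  e * (u (t + h) 0 i + u (t - h) 0 i - 2 * u t 0 i) <= e ^+ 2 + g * e * h ^+ 2.
Proof.
move=> h0 hW; have hn0 : h != 0 by rewrite gt_eqF.
pose al := e / h; pose b1 := - al * (t - h); pose b2 := al * (t + h).
pose v1 r := u r + (al * r + b1) *: (delta_mx 0 i : 'rV[R]_N).
pose v2 r := u r + (- al * r + b2) *: (delta_mx 0 i : 'rV[R]_N).
have P1 : profile W `[t - h, t] v1
    (fun r => q r + (al * u r 0 i + al ^+ 2 / 2 * r))
    (fun r => p r + (g * al / 2 * r ^+ 2 + g * b1 * r)).
  split; first by apply: kinetic_profile_affine => r s _ _; exact: kin.
  apply: (@potential_profile_affine _ _ _ _ _ _ _ u) => [r s w _ _|r].
    exact: pot.
  move=> /andP[r1 r2]; have := hW r ((r - (t - h)) / h).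
  have -> : (r - (t - h)) / h * e = al * r + b1.
    by rewrite /b1 /al; field.
  move=> hr; apply: (le_trans (hr _ _)).
  - by rewrite ler_norml; lra.
  - by rewrite ler_pdivrMr// mul1r divr_ge0 ?(ltW h0)//; lra.
  - by rewrite mulrDr mulrA addrA.
have P2 : profile W `[t, t + h] v2
    (fun r => q r + (- al * u r 0 i + (- al) ^+ 2 / 2 * r))
    (fun r => p r + (g * - al / 2 * r ^+ 2 + g * b2 * r)).
  split; first by apply: kinetic_profile_affine => r s _ _; exact: kin.
  apply: (@potential_profile_affine _ _ _ _ _ _ _ u) => [r s w _ _|r].
    exact: pot.
  move=> /andP[r1 r2]; have := hW r ((t + h - r) / h).
  have -> : (t + h - r) / h * e = - al * r + b2.
    by rewrite /b2 /al; field.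
  move=> hr; apply: (le_trans (hr _ _)).
  - by rewrite ler_norml; lra.
  - by rewrite ler_pdivrMr// mul1r divr_ge0 ?(ltW h0)//; lra.
  - by rewrite mulrDr mulrA addrA.
have {}P2 := profile_addc (2 * al * u t 0 i) (g * (al * t - b2 + b1) * t) P2.
have th : t - h <= t by lra.
have ht : t <= t + h by lra.
have e1 : v1 t = v2 t.
  by congr (_ + _ *: _); rewrite /b1 /b2 /al; field.
have it1 : `[t - h, t]%classic t by rewrite /= in_itv/= th lexx.
have it2 : `[t, t + h]%classic t by rewrite /= in_itv/= ht lexx.
have := profile_join P1 P2 it1 it2 e1 ltac:(ring) ltac:(field).
set v := join_at t _ _; set q' := join_at t _ _.
set p' := join_at t _ _ => /(_ isT) P.
have {}P : profile W `[t - h, t + h] v q' p'.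
  apply: profile_sub P => r; rewrite /= !in_itv/= => /andP[r1 r2].
  by case: leP => rt; apply/andP; split; lra.
have tht : t + h <= t = false by apply/negbTE; rewrite -ltNge; lra.
have va : v (t - h) = u (t - h).
  by rewrite /v /join_at th /v1 /b1 mulNr subrr scale0r addr0.
have vb : v (t + h) = u (t + h).
  by rewrite /v /join_at tht /v2 /b2 mulNr addNr scale0r addr0.
have thh : t - h <= t + h by lra.
have := local_minimality thh thh P va vb.
rewrite /q' /p' /join_at th tht.
set D := _ - _; move=> H.
have H1 : 0 <= h * (2 * al * u t 0 i - al * u (t + h) 0 i - al * u (t - h) 0 i
    + al ^+ 2 * h + g * al * h ^+ 2).
  rewrite mulr_ge0 ?(ltW h0)//; move: H; rewrite /D /b1 /b2; lra.
move: H1; rewrite /al.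
have -> : h * (2 * (e / h) * u t 0 i - e / h * u (t + h) 0 i -
   e / h * u (t - h) 0 i + (e / h) ^+ 2 * h + g * (e / h) * h ^+ 2) =
   e ^+ 2 + g * e * h ^+ 2 - e * (u (t + h) 0 i + u (t - h) 0 i - 2 * u t 0 i).
  by field.
by rewrite subr_ge0.
Qed.

(** The Euler-Lagrange equation in difference form: per unit height of the tent,
the kinetic variation is [- 1 / h] times the second difference of [u], and the
potential one is the gradient times [h], the integral of the tent. *)
Lemma second_difference t i e : 0 < e -> exists2 h0, 0 < h0 &
  forall h, 0 < h -> h < h0 ->
  `|u (t + h) 0 i + u (t - h) 0 i - 2 * u t 0 i - h ^+ 2 * grad W (u t) 0 i|
    <= e * h ^+ 2.
Proof.
move=> e0; have m0 := m_ge0; have m1 : 0 < 2 * m + 1 by lra.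
have [dW cW] := W_diff (@avoids_wells t).
have [r r0 hr] := grad_increment i dW cW e0.
set g := grad W (u t) 0 i.
exists (r / (2 * m + 1)); first by rewrite divr_gt0.
move=> h h0; rewrite ltr_pdivlMr// => hr1.
set D := _ - 2 * u t 0 i.
have close s : `|s - t| <= h -> sqn (u s - u t) < r.
  move=> st; apply: le_lt_trans (u_holder _ _) _.
  have : 2 * m * `|s - t| <= 2 * m * h by apply: ler_wpM2l => //; lra.
  by lra.
have step x0 s : x0 ^+ 2 < r -> `|s - t| <= h -> forall x, 0 <= x <= 1 ->
    `|W (u s + (x * x0) *: delta_mx 0 i) - W (u s) - x * x0 * g| <= e * (x * `|x0|).
  move=> x0r st x /andP[xge0 xle1].
  have := hr (u s) (x * x0) (close s st); rewrite normrM (ger0_norm xge0).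
  apply; apply: le_lt_trans x0r; rewrite exprMn ler_piMl ?sqr_ge0//.
  exact: exprn_ile1.
have up x : 0 < x -> x ^+ 2 < r -> D <= x + (g + e) * h ^+ 2.
  move=> x0 xr; have := @tent_variation t i h x (g + e) h0 => T.
  have {}T : x * D <= x ^+ 2 + (g + e) * x * h ^+ 2.
    apply: T => s y st y01; have := step x s xr st y y01.
    by rewrite ler_norml => /andP[_]; rewrite (gtr0_norm x0); lra.
  rewrite -(ler_pM2l x0); apply: le_trans T _.
  by rewrite le_eqVlt; apply/orP; left; apply/eqP; ring.
have lo x : 0 < x -> x ^+ 2 < r -> - x + (g - e) * h ^+ 2 <= D.
  move=> x0 xr; have := @tent_variation t i h (- x) (g - e) h0 => T.
  have {}T : - x * D <= (- x) ^+ 2 + (g - e) * - x * h ^+ 2.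
    apply: T => s y st y01; have := step (- x) s _ st y y01.
    rewrite sqrrN normrN => /(_ xr); rewrite ler_norml => /andP[_].
    by rewrite (gtr0_norm x0); lra.
  rewrite -(ler_pM2l x0) -lerN2 -mulNr; apply: le_trans T _.
  by rewrite le_eqVlt; apply/orP; left; apply/eqP; ring.
have small x : 0 < x -> exists y, [/\ 0 < y, y <= x & y ^+ 2 < r].
  move=> x0; exists (Num.min x (Num.min 1 (r / 2))); split.
  - by rewrite !lt_min x0 ltr01 divr_gt0.
  - by rewrite ge_min lexx.
  set y := Num.min 1 (r / 2); have y1 : y <= 1 by rewrite ge_min lexx.
  have y2 : y <= r / 2 by rewrite ge_min lexx orbT.
  have y0 : 0 < y by rewrite lt_min ltr01 divr_gt0.
  set z := Num.min x y; have zy : z <= y by rewrite ge_min lexx orbT.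
  have z0 : 0 < z by rewrite lt_min x0 y0.
  by nra.
rewrite ler_norml; apply/andP; split; apply/ler_addgt0Pr => x /small[y [y0 yx yr]].
  by have := lo y y0 yr; lra.
by have := up y y0 yr; lra.
Qed.

End Minimizer.

(** * Primitives and Schwarz's theorem *)

Section Primitives.
Context {R : realType}.
Notation mu := (@lebesgue_measure R).
Implicit Types f g F : R -> R.

Definition interval_integrable f :=
  forall a b, mu.-integrable `[a, b] (EFin \o f).

Definition primitive f (t : R) : R :=
  if 0 <= t then \int[mu]_(x in `[0, t]) f x else - \int[mu]_(x in `[t, 0]) f x.

Lemma continuous_interval_integrable f : continuous f -> interval_integrable f.
Proof.
move=> cf a b; apply: continuous_compact_integrable; first exact: segment_compact.
exact: continuous_subspaceT.
Qed.

Lemma Rintegral_chasles f a b c : interval_integrable f -> a <= b -> b <= c ->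
  \int[mu]_(x in `[a, c]) f x =
  \int[mu]_(x in `[a, b]) f x + \int[mu]_(x in `[b, c]) f x.
Proof.
move=> fi ab bc.
have := @Rintegral_itvB R f (BLeft a) (BRight c) b (fi a c).
rewrite !bnd_simp => /(_ ab bc) h.
rewrite -(@Rintegral_itv_obnd_cbnd R b (BRight c)); first by rewrite -h addrC subrK.
apply: integrableS (fi b c) => //.
by apply: subset_itvr; rewrite bnd_simp.
Qed.

Lemma primitiveB f s t : interval_integrable f -> s <= t ->
  primitive f t - primitive f s = \int[mu]_(x in `[s, t]) f x.
Proof.
move=> fi st; rewrite /primitive; case: (leP 0 s) => s0; case: (leP 0 t) => t0.
- by rewrite (Rintegral_chasles fi s0 st) addrC addKr.
- by move: (le_lt_trans (le_trans s0 st) t0); rewrite ltxx.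
- by rewrite opprK addrC -(Rintegral_chasles fi (ltW s0) t0).
- by rewrite (Rintegral_chasles fi st (ltW t0)) opprK addrC addrK.
Qed.

Lemma is_derive_primitive f (x : R) : interval_integrable f -> lebesgue_pt f x ->
  is_derive x 1 (primitive f) (f x).
Proof.
move=> fi fx; pose a := x - 1; pose F y := \int[mu]_(t in `[a, y]) f t.
have [dF F1] : derivable F x 1 /\ derive1 F x = f x.
  apply: (@FTC1_lebesgue_pt R f (BLeft a) x (x + 1)) => //; first by rewrite ltrDl.
  by rewrite lte_fin /a; lra.
apply: (@near_eq_is_derive _ _ _ (fun y => primitive f a + F y)).
  have : \forall y \near x, a < y.
    by apply: lt_nbhsr; rewrite /a; lra.
  apply: filterS => y ay; rewrite /F -primitiveB ?(ltW ay)//.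
  by rewrite addrC subrK.
have -> : (fun y => primitive f a + F y) = cst (primitive f a) + F by [].
rewrite -[X in is_derive _ _ _ X]add0r; apply: is_deriveD.
by apply: DeriveDef; [exact: dF|rewrite -derive1E; exact: F1].
Qed.

Lemma is_derive_primitive_continuous f (x : R) : continuous f ->
  is_derive x 1 (primitive f) (f x).
Proof.
move=> cf; apply: is_derive_primitive.
  exact: continuous_interval_integrable.
apply: (@continuous_lebesgue_pt _ _ _ setT) => //.
- by split => //; exact: openT.
- exact: measurable_realfun.continuous_measurable_fun.
- exact: cf.
Qed.

Lemma is_derive_continuous F f : (forall x : R, is_derive x 1 F (f x)) ->
  continuous F.
Proof.
move=> dF x; apply/differentiable_continuous; rewrite -derivable1_diffP.
by have [] := dF x.
Qed.

End Primitives.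

Section Schwarz.
Context {R : realType}.
Implicit Types G : R -> R.

(** If the second symmetric differences of [G] are at least [o(h^2)], adding a
small convex parabola makes them positive, which forbids an interior maximum:
[G] lies below its chords. *)
Lemma below_chord G (a b : R) : a < b -> continuous G ->
  (forall t e, 0 < e -> exists2 h0, 0 < h0 & forall h, 0 < h -> h < h0 ->
    - (e * h ^+ 2) <= G (t + h) + G (t - h) - 2 * G t) ->
  forall t, a <= t <= b -> G t <= G a + (t - a) / (b - a) * (G b - G a).
Proof.
move=> ab cG hG t /andP[at_ tb].
pose l := (G b - G a) / (b - a).
have lE : (t - a) / (b - a) * (G b - G a) = l * (t - a) by rewrite /l; field; lra.
have lb : l * (b - a) = G b - G a by rewrite /l divfK//; lra.
rewrite lE leNgt; apply/negP => above.
pose d := G t - (G a + l * (t - a)); have d0 : 0 < d by rewrite /d; lra.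
pose e := d / ((b - a) ^+ 2 + 1).
have ba1 : 0 < (b - a) ^+ 2 + 1 by rewrite ltr_wpDl// sqr_ge0.
have e0 : 0 < e by rewrite divr_gt0.
have eba : e * (b - a) ^+ 2 < d.
  by rewrite /e mulrAC ltr_pdivrMr// ltr_pM2l// ltrDl.
pose f s := G s - (G a + l * (s - a)) + e * ((s - a) * (s - b)).
have cf : continuous f.
  move=> s; rewrite /f; apply: cvgD; first apply: cvgB; first exact: cG.
    apply: cvgD; first exact: cvg_cst.
    by apply: cvgM; [exact: cvg_cst|apply: cvgB; [exact: cvg_id|exact: cvg_cst]].
  apply: cvgM; first exact: cvg_cst.
  by apply: cvgM; (apply: cvgB; [exact: cvg_id|exact: cvg_cst]).
have [c cab hc] := EVT_max (ltW ab) (continuous_subspaceT cf).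
have fa : f a = 0 by rewrite /f subrr; ring.
have fb : f b = 0 by rewrite /f lb subrr; ring.
have ft : 0 < f t.
  have : (t - a) * (b - t) <= (b - a) ^+ 2.
    rewrite expr2; apply: ler_pM; lra.
  rewrite /f -/d => h.
  have := ler_pM2l e0 ((t - a) * (b - t)) ((b - a) ^+ 2).
  by rewrite h => he; nra.
have fc : 0 < f c by apply: lt_le_trans ft _; apply: hc; rewrite in_itv/= at_ tb.
move: cab; rewrite in_itv/= !le_eqVlt => /andP[/predU1P[ca|ac] /predU1P[cb|cb]].
- by move: fc; rewrite -ca fa ltxx.
- by move: fc; rewrite -ca fa ltxx.
- by move: fc; rewrite cb fb ltxx.
have [h0 h00 hh] := hG c e e0.
pose h := Num.min (h0 / 2) (Num.min (c - a) (b - c)).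
have hgt : 0 < h by rewrite !lt_min divr_gt0// !subr_gt0 ac cb.
have h1 : h < h0.
  have : h <= h0 / 2 by rewrite ge_min lexx.
  by lra.
have h2 : h <= c - a by rewrite /h !ge_min lexx orbT.
have h3 : h <= b - c by rewrite /h !ge_min lexx !orbT.
have k1 : f (c + h) <= f c by apply: hc; rewrite in_itv/=; apply/andP; split; lra.
have k2 : f (c - h) <= f c by apply: hc; rewrite in_itv/=; apply/andP; split; lra.
have := hh h hgt h1.
have : 0 < e * h ^+ 2 by rewrite mulr_gt0// exprn_gt0.
by move: k1 k2; rewrite /f; lra.
Qed.

(** Schwarz: a continuous function with vanishing symmetric second derivative is
affine. *)
Lemma schwarz_affine G : continuous G ->
  (forall t e, 0 < e -> exists2 h0, 0 < h0 & forall h, 0 < h -> h < h0 ->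
    `|G (t + h) + G (t - h) - 2 * G t| <= e * h ^+ 2) ->
  forall t, G t = G 0 + t * (G 1 - G 0).
Proof.
move=> cG hG.
have chord a b t : a < b -> a <= t <= b ->
    G t = G a + (t - a) / (b - a) * (G b - G a).
  move=> ab tab; apply/le_anti/andP; split.
    apply: below_chord => // s e /(hG s)[h0 h00 hh]; exists h0 => // h hgt hlt.
    by have := hh h hgt hlt; rewrite ler_norml => /andP[].
  have H : - G t <= - G a + (t - a) / (b - a) * (- G b - - G a).
    apply: (@below_chord (fun s => - G s)) => //.
      by move=> s; apply: cvgN; exact: cG.
    move=> s e /(hG s)[h0 h00 hh]; exists h0 => // h hgt hlt.
    by have := hh h hgt hlt; rewrite ler_norml => /andP[_]; lra.
  by move: H; set c := (t - a) / (b - a); lra.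
move=> t; pose A := `|t| + 2.
have t1 : - A <= t by rewrite /A; have := lerNnormlW (lexx `|t|); lra.
have t2 : t <= A by rewrite /A; have := ler_norm t; lra.
have A2 : 2 <= A by rewrite /A lerDr.
have AA : - A < A by lra.
have E s : - A <= s <= A -> G s = G (- A) + (s + A) / (A + A) * (G A - G (- A)).
  by move=> sA; rewrite (chord _ _ s AA sA) !opprK.
rewrite (E t) ?t1 ?t2// (E 0) ?(E 1); [|lra..].
by field; lra.
Qed.

End Schwarz.

(** * From second differences to second derivatives *)

Section Regularity.
Context {R : realType}.
Implicit Types f y F : R -> R.

Lemma is_derive_affine (c t s : R) : is_derive s 1 (fun r : R => t + c * r) c.
Proof.
have -> : (fun r : R => t + c * r) = cst t + (c \*: id) by apply/funext => r.
by apply: is_derive_eq; rewrite add0r; exact: mulr1.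
Qed.

Lemma is_derive_affine_arg F (c t s d : R) : is_derive (t + c * s) 1 F d ->
  is_derive s 1 (fun r => F (t + c * r)) (c * d).
Proof.
move=> dF.
have da := is_derive_affine c t s.
by apply: is_derive_eq (@is_derive1_comp _ F _ s _ _ dF da) _; rewrite mulrC.
Qed.

Lemma mvt_bound (F f : R -> R) (h B : R) : 0 <= h -> F 0 = 0 ->
  (forall s : R, 0 <= s -> s <= h -> is_derive s 1 F (f s)) ->
  (forall s, 0 <= s -> s <= h -> `|f s| <= B) -> `|F h| <= B * h.
Proof.
move=> h0 F0 dF fB.
have [||c] := @MVT_segment R F f 0 h h0.
- by move=> s; rewrite in_itv/= => /andP[/ltW s0 /ltW sh]; exact: dF.
- apply: derivable_within_continuous => s; rewrite in_itv/= => /andP[s0 sh].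
  by have [] := dF s s0 sh.
rewrite in_itv/= => /andP[c0 ch]; rewrite F0 !subr0 => ->.
by rewrite normrM (ger0_norm h0) ler_wpM2r// fB.
Qed.

Lemma second_difference_primitive f F1 F (t e : R) : continuous f ->
  (forall s : R, is_derive s 1 F1 (f s)) ->
  (forall s : R, is_derive s 1 F (F1 s)) ->
  0 < e -> exists2 h0, 0 < h0 & forall h, 0 < h -> h < h0 ->
    `|F (t + h) + F (t - h) - 2 * F t - h ^+ 2 * f t| <= e * h ^+ 2.
Proof.
move=> cf dF1 dF e0.
have e20 : 0 < e / 2 by rewrite divr_gt0.
have /cvgrPdist_lt/(_ _ e20)/nbhs_ballP[h0 /= h00 hf] := cf t.
exists h0 => // h hgt hlt.
pose psi s := F1 (t + s) - F1 (t - s) - 2 * s * f t.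
pose phi s := F (t + s) + F (t - s) - 2 * F t - s ^+ 2 * f t.
have dd (G g : R -> R) (s : R) : (forall r : R, is_derive r 1 G (g r)) ->
    is_derive s 1 (fun r => G (t + r)) (g (t + s)) /\
    is_derive s 1 (fun r => G (t - r)) (- g (t - s)).
  move=> dG; split.
    have := @is_derive_affine_arg G 1 t s _ (dG _); rewrite !mul1r.
    by under eq_fun do rewrite mul1r.
  have := @is_derive_affine_arg G (-1) t s _ (dG _); rewrite !mulN1r.
  by under eq_fun do rewrite mulN1r.
have dpsi (s : R) : is_derive s 1 psi (f (t + s) + f (t - s) - 2 * f t).
  have [d1 d2] := dd F1 f s dF1.
  have -> : psi = (fun r => F1 (t + r)) - (fun r => F1 (t - r)) - ((2 * f t) \*: id).
    by apply/funext => r; rewrite /psi mulrAC.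
  by apply: is_derive_eq; rewrite opprK [_ *: 1]mulr1.
have dphi (s : R) : is_derive s 1 phi (psi s).
  have [d1 d2] := dd F F1 s dF.
  have -> : phi = (fun r => F (t + r)) + (fun r => F (t - r)) - cst (2 * F t)
      - (f t \*: (id ^+ 2)).
    by apply/funext => r; rewrite /phi [_ ^+ 2 * _]mulrC.
  by apply: is_derive_eq; rewrite /psi subr0 [_ *: 1]mulr1 [_ *: _]mulrC expr1.
have psi0 : psi 0 = 0 by rewrite /psi addr0 subr0 subrr mulr0 mul0r subr0.
have phi0 : phi 0 = 0.
  by rewrite /phi addr0 subr0 expr0n mul0r subr0 -mulr2n mulr_natl subrr.
have psiB s : 0 <= s -> s <= h -> `|psi s| <= e * s.
  move=> s0 sh.
  apply: (@mvt_bound psi (fun r => f (t + r) + f (t - r) - 2 * f t) s e s0 psi0).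
  move=> r r0 rs.
  have h1 : `|f t - f (t + r)| < e / 2.
    apply: hf; rewrite -ball_normE/= opprD addrA subrr add0r normrN ger0_norm//.
    by lra.
  have h2 : `|f t - f (t - r)| < e / 2.
    apply: hf; rewrite -ball_normE/= opprB addrC subrK ger0_norm//.
    by lra.
  move: h1 h2; rewrite !ltr_norml => /andP[? ?] /andP[? ?].
  by rewrite ler_norml; apply/andP; split; lra.
have := @mvt_bound phi psi h (e * h) (ltW hgt) phi0.
rewrite -mulrA -expr2; apply => s s0 sh.
by rewrite (le_trans (psiB s s0 sh))// ler_pM2l.
Qed.

(** The difference of [y] and a second primitive of [f] has vanishing second
symmetric derivative, hence is affine. *)
Lemma second_difference_C2 y f : continuous y -> continuous f ->
  (forall t e, 0 < e -> exists2 h0, 0 < h0 & forall h, 0 < h -> h < h0 ->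
    `|y (t + h) + y (t - h) - 2 * y t - h ^+ 2 * f t| <= e * h ^+ 2) ->
  exists2 y1, forall t : R, is_derive t 1 y (y1 t) &
    forall t : R, is_derive t 1 y1 (f t).
Proof.
move=> cy cf hy.
pose F1 := primitive f; pose F := primitive F1.
have dF1 (t : R) : is_derive t 1 F1 (f t) by exact: is_derive_primitive_continuous.
have cF1 := is_derive_continuous dF1.
have dF (t : R) : is_derive t 1 F (F1 t) by exact: is_derive_primitive_continuous.
have cF := is_derive_continuous dF.
pose G t := y t - F t.
have cG : continuous G by move=> t; apply: cvgB; [exact: cy|exact: cF].
have aff : forall t, G t = G 0 + t * (G 1 - G 0).
  apply: schwarz_affine => // t e e0.
  have e20 : 0 < e / 2 by rewrite divr_gt0.
  have [h1 h10 hy1] := hy t _ e20.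
  have [h2 h20 hF2] := second_difference_primitive t cf dF1 dF e20.
  exists (Num.min h1 h2); first by rewrite lt_min h10.
  move=> h h0; rewrite lt_min => /andP[hh1 hh2].
  have := hy1 h h0 hh1; have := hF2 h h0 hh2.
  rewrite !ler_norml /G => /andP[? ?] /andP[? ?].
  by apply/andP; split; lra.
exists (fun t => F1 t + (G 1 - G 0)) => t; last first.
  have -> : (fun t => F1 t + (G 1 - G 0)) = F1 + cst (G 1 - G 0) by [].
  by apply: is_derive_eq; rewrite addr0.
have -> : y = F + (fun s => G 0 + (G 1 - G 0) * s).
  apply/funext => s; change (y s = F s + (G 0 + (G 1 - G 0) * s)).
  by rewrite [_ * s]mulrC -aff /G addrC subrK.
apply: is_deriveD; exact: is_derive_affine.
Qed.

End Regularity.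

(** * The energy of a C1 curve is bounded by its profiles *)

Section EnergyOfC1Curves.
Context {R : realType}.

Lemma mvt_increment (F f : R -> R) (x y : R) : x <= y ->
  (forall s : R, is_derive s 1 F (f s)) ->
  exists2 c, x <= c <= y & F y - F x = f c * (y - x).
Proof.
move=> xy dF; have [|c] := @MVT_segment R F f x y xy.
  by apply: derivable_within_continuous => s _; have [] := dF s.
by rewrite in_itv/= => cxy ->; exists c.
Qed.

(** Compactness of [[s, t]] turns the local condition into the uniform one. *)
Lemma almost_nondecreasing_local (f : R -> R) (s t : R) : s <= t ->
  (forall x0 e, 0 < e -> exists2 d, 0 < d & forall x y,
    `|x - x0| < d -> `|y - x0| < d -> x <= y -> - (e * (y - x)) <= f y - f x) ->
  f s <= f t.
Proof.
move=> st h; apply: almost_nondecreasing => // e e0.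
have : \forall d \near 0^'+, `[s, t] `<=` (fun x => forall y, x <= y -> y - x < d ->
    - (e * (y - x)) <= f y - f x).
  have /compact_near_coveringP := @segment_compact R s t.
  apply => x0 _; have [d d0 hd] := h x0 e e0.
  have d20 : 0 < d / 2 by rewrite divr_gt0.
  near=> x r => /= y xy yx.
  have xd : `|x0 - x| < d / 2 by near: x; exact: near_dist.
  have rd : r < d / 2 by near: r; exact: nbhs_right_lt.
  move: xd; rewrite ltr_norml => /andP[? ?].
  by apply: hd; rewrite ?ltr_norml//; apply/andP; split; lra.
move=> near0; near (0 : R)^'+ => d.
exists d; first by near: d; exact: nbhs_right_gt.
move=> x y sx xy yt yx.
have : `[s, t] `<=` (fun x => forall y, x <= y -> y - x < d ->
    - (e * (y - x)) <= f y - f x) by near: d.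
apply => //; rewrite /= in_itv/= sx/=; exact: le_trans xy yt.
Unshelve. all: by end_near. Qed.

Context {N : nat} {W : 'rV[R]_N -> R}.
Hypothesis W_cont : continuous W.
Variables (u u1 : R -> 'rV[R]_N) (q p : R -> R).
Hypothesis du : forall (t : R) i, is_derive t 1 (fun s => u s 0 i) (u1 t 0 i).
Hypothesis u_cont : continuous u.
Hypothesis u1_cont : continuous u1.

Lemma continuous_energy_density :
  continuous (fun x => 2^-1 * sqn (u1 x) + W (u x)).
Proof.
move=> x; apply: cvgD.
  by apply: cvgM; [exact: cvg_cst|apply: cvg_sqn; exact: u1_cont].
by apply: continuous_cvg; [exact: W_cont|exact: u_cont].
Qed.

Lemma sqn_increment_lower (x0 e : R) : 0 < e -> exists2 d, 0 < d & forall x y,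
  `|x - x0| < d -> `|y - x0| < d -> x <= y ->
  (y - x) ^+ 2 * (sqn (u1 x0) - e) <= sqn (u y - u x).
Proof.
move=> e0; have eN : 0 < e / N.+1%:R by rewrite divr_gt0.
have : \forall s \near x0, forall i, u1 x0 0 i ^+ 2 - e / N.+1%:R < u1 s 0 i ^+ 2.
  apply: (@filter_forall R 'I_N
    (fun i s => u1 x0 0 i ^+ 2 - e / N.+1%:R < u1 s 0 i ^+ 2)
    (nbhs x0) (nbhs_filter x0)) => i.
  have c1 : u1 s 0 i @[s --> x0] --> u1 x0 0 i.
    exact: (continuous_cvg _ (@coord_continuous R 1 N 0 i (u1 x0)) (@u1_cont x0)).
  apply: (cvgr_gt _ (cvgM c1 c1)).
  by rewrite -expr2 ltrBlDr ltrDl.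
move=> /nbhs_ballP[d /= d0 hd]; exists d => // x y xd yd xy.
have eS : \sum_(i < N) (e / N.+1%:R) <= e.
  rewrite sumr_const card_ord -[_ *+ N]mulr_natr mulrAC ler_pdivrMr ?ltr0n//.
  by rewrite ler_pM2l// ler_nat.
apply: (@le_trans _ _ (\sum_(i < N) (y - x) ^+ 2 * (u1 x0 0 i ^+ 2 - e / N.+1%:R))).
  rewrite -mulr_sumr; apply: ler_wpM2l; first exact: sqr_ge0.
  by rewrite sumrB lerD2l lerN2.
apply: ler_sum => i _; rewrite !mxE.
have [c cxy ->] := mvt_increment xy (fun s => @du s i).
rewrite exprMn mulrC ler_wpM2r ?sqr_ge0//; apply/ltW/hd.
rewrite -ball_normE/= distrC; move: cxy xd yd.
rewrite !ltr_norml => /andP[? ?] /andP[? ?] /andP[? ?].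
by apply/andP; split; lra.
Qed.

Lemma energy_integral_le s t : kinetic_profile setT u q ->
  potential_profile W setT u p -> s <= t ->
  \int[lebesgue_measure]_(x in `[s, t]) (2^-1 * sqn (u1 x) + W (u x)) <=
  (q t + p t) - (q s + p s).
Proof.
move=> kin pot st; set h := fun x => 2^-1 * sqn (u1 x) + W (u x).
have ch : continuous h := continuous_energy_density.
rewrite -(primitiveB (continuous_interval_integrable ch) st).
suff : q s + p s - primitive h s <= q t + p t - primitive h t by lra.
apply: (@almost_nondecreasing_local (fun r => q r + p r - primitive h r)) => //.
move=> x0 e e0; have e40 : 0 < e / 4 by rewrite divr_gt0.
have /cvgrPdist_lt/(_ _ e40)/nbhs_ballP[d1 /= d10 h1] := ch x0.
have cWu : W (u r) @[r --> x0] --> W (u x0).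
  by apply: continuous_cvg; [exact: W_cont|exact: u_cont].
have /cvgrPdist_lt/(_ _ e40)/nbhs_ballP[d2 /= d20 h2] := cWu.
have [d3 d30 h3] := sqn_increment_lower x0 e40.
exists (Num.min d1 (Num.min d2 d3)); first by rewrite !lt_min d10 d20.
move=> x y; rewrite !lt_min => /andP[x1 /andP[x2 x3]] /andP[y1 /andP[y2 y3]].
rewrite le_eqVlt => /predU1P[->|xy]; first by rewrite !subrr mulr0 oppr0.
have xy' := ltW xy.
have between c d : x <= c <= y -> `|x - x0| < d -> `|y - x0| < d -> ball x0 d c.
  move=> cxy xd yd; rewrite -ball_normE/= distrC; move: cxy xd yd.
  rewrite !ltr_norml => /andP[? ?] /andP[? ?] /andP[? ?].
  by apply/andP; split; lra.
have hp : primitive h y - primitive h x <= (h x0 + e / 4) * (y - x).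
  have [c cxy ->] := mvt_increment xy' (fun s => is_derive_primitive_continuous s ch).
  apply: ler_wpM2r; first by rewrite subr_ge0.
  by have := h1 c (between _ _ cxy x1 y1); rewrite ltr_norml => /andP[? ?]; lra.
have hpot : (W (u x0) - e / 4) * (y - x) <= p y - p x.
  apply: pot => // r rxy.
  by have := h2 r (between _ _ rxy x2 y2); rewrite ltr_norml => /andP[? ?]; lra.
have hkin : 2^-1 * (sqn (u1 x0) - e / 4) * (y - x) <= q y - q x.
  have := le_trans (h3 x y x3 y3 xy') (kin x y I I xy').
  have -> : (y - x) ^+ 2 * (sqn (u1 x0) - e / 4) =
    (2 * (y - x)) * (2^-1 * (sqn (u1 x0) - e / 4) * (y - x)) by field.
  by rewrite ler_pM2l// mulr_gt0// subr_gt0.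
have e1 : 0 <= e * (y - x) by rewrite mulr_ge0 ?(ltW e0)// subr_ge0.
by move: hp hpot hkin; rewrite {3}/h; lra.
Qed.

End EnergyOfC1Curves.

(** * Vector-valued curves *)

Section VectorRegularity.
Context {R : realType} {N : nat}.
Implicit Types u v f : R -> 'rV[R]_N.

Lemma derive1_coords u v (t : R) :
  (forall i, is_derive t 1 (fun s => u s 0 i) (v t 0 i)) ->
  derivable u t 1 /\ derive1 u t = v t.
Proof.
move=> du.
have d : derivable u t 1.
  by apply/derivable_mxP => i j; rewrite (ord1 i); have [] := du j.
split=> //; rewrite derive1E derive_mx//; apply/rowP => j; rewrite mxE.
by have [_] := du j.
Qed.

Lemma continuous_coords u v :
  (forall (t : R) i, is_derive t 1 (fun s => u s 0 i) (v t 0 i)) -> continuous u.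
Proof.
move=> du t; apply/differentiable_continuous/derivable1_diffP.
by have [] := @derive1_coords u v t (du t).
Qed.

Lemma coords_C2 u f : continuous u -> continuous f ->
  (forall (t : R) i e, 0 < e -> exists2 h0, 0 < h0 & forall h, 0 < h -> h < h0 ->
    `|u (t + h) 0 i + u (t - h) 0 i - 2 * u t 0 i - h ^+ 2 * f t 0 i|
      <= e * h ^+ 2) ->
  exists u1, [/\ forall (t : R) i, is_derive t 1 (fun s => u s 0 i) (u1 t 0 i),
    continuous u1 & C2 u /\ derive1 (derive1 u) = f].
Proof.
move=> cu cf hu.
have /choice[y hy] : forall i, exists y1 : R -> R,
    (forall t : R, is_derive t 1 (fun s => u s 0 i) (y1 t)) /\
    (forall t : R, is_derive t 1 y1 (f t 0 i)).
  move=> i.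
  have [|||y1 h1 h2] := @second_difference_C2 R (fun s => u s 0 i) (fun s => f s 0 i).
  - exact: continuous_coord.
  - exact: continuous_coord.
  - by move=> t e; exact: hu.
  - by exists y1.
pose u1 t := \row_i y i t.
have d1 (t : R) i : is_derive t 1 (fun s => u s 0 i) (u1 t 0 i).
  by rewrite mxE; exact: (hy i).1.
have d2 (t : R) i : is_derive t 1 (fun s => u1 s 0 i) (f t 0 i).
  have -> : (fun s => u1 s 0 i) = y i by apply/funext => s; rewrite mxE.
  exact: (hy i).2.
have e1 : derive1 u = u1.
  by apply/funext => t; have [] := @derive1_coords u u1 t (d1 t).
have e2 : derive1 u1 = f.
  by apply/funext => t; have [] := @derive1_coords u1 f t (d2 t).
exists u1; split => //; first exact: (continuous_coords d2).
rewrite /C2 e1 e2; split => //; split => // t.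
  by have [] := @derive1_coords u u1 t (d1 t).
by have [] := @derive1_coords u1 f t (d2 t).
Qed.

Lemma tends_Ny_cvg u a : tends_Ny u a -> u x @[x --> -oo] --> a.
Proof.
move=> h; apply/sqn_cvgP => e /h[T hT].
by exists T; split; [exact: num_real|move=> t /ltW; exact: hT].
Qed.

Lemma tends_y_cvg u a : tends_y u a -> u x @[x --> +oo] --> a.
Proof.
move=> h; apply/sqn_cvgP => e /h[T hT].
by exists T; split; [exact: num_real|move=> t /ltW; exact: hT].
Qed.

Lemma cvg_tends_Ny u a : u x @[x --> -oo] --> a -> tends_Ny u a.
Proof.
move=> /sqn_cvgP h e /h [T [_ hT]]; exists (T - 1) => t tT; apply: hT.
by lra.
Qed.

Lemma cvg_tends_y u a : u x @[x --> +oo] --> a -> tends_y u a.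
Proof.
move=> /sqn_cvgP h e /h [T [_ hT]]; exists (T + 1) => t tT; apply: hT.
by lra.
Qed.

End VectorRegularity.

(** * Smooth steps *)

Section IntegralTools.
Context {R : realType}.
Notation mu := (@lebesgue_measure R).
Implicit Types f g k F : R -> R.

Lemma Rintegral_support F a b : (forall x, ~ (a <= x <= b) -> F x = 0) ->
  \int[mu]_x F x = \int[mu]_(x in `[a, b]) F x.
Proof.
move=> h; rewrite [RHS]Rintegral_mkcond; apply: eq_Rintegral => x _.
rewrite patchE; case: ifPn => //; rewrite notin_setE/= in_itv/= => nx.
exact: h.
Qed.

Lemma interval_integrableM f k : interval_integrable f -> continuous k ->
  interval_integrable (fun x => f x * k x).
Proof.
move=> fi ck a b.
have -> : (EFin \o (fun x => f x * k x)) = ((EFin \o f) \* (EFin \o k))%E.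
  by apply/funext => x; rewrite /= EFinM.
apply: integrableMl; [exact: measurable_itv|exact: fi| |].
  apply: measurable_funTS; exact: measurable_realfun.continuous_measurable_fun.
have /compact_bounded[M [Mr hM]] : compact (k @` `[a, b]).
  apply: continuous_compact; last exact: segment_compact.
  exact: continuous_subspaceT.
exists M; split => // M' MM' x xab; apply: (hM _ MM'); exact: imageP.
Qed.

Lemma Rintegral_derive F f a b : a <= b -> continuous f ->
  (forall x : R, is_derive x 1 F (f x)) ->
  \int[mu]_(x in `[a, b]) f x = F b - F a.
Proof.
move=> ab cf dF.
rewrite -(primitiveB (continuous_interval_integrable cf) ab).
have d0 (x : R) : is_derive x 1 (F - primitive f) (f x - f x).
  apply: is_deriveB; exact: is_derive_primitive_continuous.
have [c _] := mvt_increment ab d0.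
rewrite subrr mul0r => h; have {}h : (F b - primitive f b) - (F a - primitive f a) = 0 := h.
by lra.
Qed.

Lemma is_derive_quadratic_bound F (x d : R) :
  (forall h, `|F (x + h) - F x - h * d| <= h ^+ 2) -> is_derive x 1 F d.
Proof.
move=> hF.
have lim : h^-1 *: ((F \o shift x) (h *: (1 : R)) - F x) @[h --> 0^'] --> d.
  apply/cvgrPdist_lt => e e0; near=> h.
  have h0 : h != 0 by near: h; exact: nbhs_dnbhs_neq.
  have he : `|h| < e by near: h; exact: dnbhs0_lt.
  rewrite /= [h *: 1]mulr1 -[d](mulKf h0) -[_ *: _]/(h^-1 * _) -mulrBr normrM.
  rewrite normfV ltr_pdivrMl ?normr_gt0// distrC.
  apply: (@le_lt_trans _ _ (h ^+ 2)).
    by have := hF h; rewrite [h + x]addrC.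
  by rewrite -[h ^+ 2]ger0_norm ?sqr_ge0// normrX expr2 ltr_pM2l ?normr_gt0.
split; first by apply/cvg_ex; exists d.
exact/cvg_lim.
Unshelve. all: by end_near. Qed.

End IntegralTools.

Section Ramp.
Context {R : realType}.

Definition pos_part (x : R) : R := Num.max x 0.

Definition tent (x : R) : R := pos_part (x + 1) - 2 * pos_part x + pos_part (x - 1).

(** A C1 step from 0 on [x <= -1] to 1 on [x >= 1], the primitive of the tent;
the squares of the positive parts make it C1. *)
Definition ramp (x : R) : R := 2^-1 * pos_part (x + 1) ^+ 2 -
  pos_part x ^+ 2 + 2^-1 * pos_part (x - 1) ^+ 2.

Lemma pos_part_id x : 0 <= x -> pos_part x = x.
Proof. by move=> x0; apply/max_idPl. Qed.

Lemma pos_part_0 x : x <= 0 -> pos_part x = 0.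
Proof. by move=> x0; apply/max_idPr. Qed.

Lemma continuous_pos_part : continuous pos_part.
Proof. by move=> x; apply: continuous_max; [exact: cvg_id|exact: cvg_cst]. Qed.

Lemma continuous_tent : continuous tent.
Proof.
have c (k : R) : continuous (fun x => pos_part (x + k)).
  move=> x; apply: continuous_cvg; first exact: continuous_pos_part.
  by apply: cvgD; [exact: cvg_id|exact: cvg_cst].
move=> x; apply: cvgD; last exact: c.
apply: cvgB; first exact: c.
by apply: cvgM; [exact: cvg_cst|exact: continuous_pos_part].
Qed.

Lemma is_derive_pos_part_sqr (k x : R) :
  is_derive x 1 (fun y => 2^-1 * pos_part (y + k) ^+ 2) (pos_part (x + k)).
Proof.
apply: is_derive_quadratic_bound => h.
rewrite (addrAC x h k); set y := x + k.
rewrite ler_norml; have [y0|/ltW y0] := leP 0 y; have [z0|/ltW z0] := leP 0 (y + h);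
  rewrite ?(pos_part_id y0) ?(pos_part_0 y0) ?(pos_part_id z0) ?(pos_part_0 z0);
  apply/andP; split; nra.
Qed.

Lemma is_derive_ramp (x : R) : is_derive x 1 ramp (tent x).
Proof.
have -> : ramp = (fun y => 2^-1 * pos_part (y + 1) ^+ 2) -
    2 \*: (fun y => 2^-1 * pos_part (y + 0) ^+ 2) +
    (fun y => 2^-1 * pos_part (y + (-1)) ^+ 2).
  apply/funext => y; rewrite /ramp.
  change (2^-1 * pos_part (y + 1) ^+ 2 - pos_part y ^+ 2 + 2^-1 * pos_part (y - 1) ^+ 2 =
   2^-1 * pos_part (y + 1) ^+ 2 - 2 * (2^-1 * pos_part (y + 0) ^+ 2) +
   2^-1 * pos_part (y - 1) ^+ 2).
  by rewrite addr0 mulrA mulfV// mul1r.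
have d0 := is_derive_pos_part_sqr 0 x; rewrite addr0 in d0.
have d1 := is_derive_pos_part_sqr 1 x.
have d2 := is_derive_pos_part_sqr (-1) x.
apply: is_deriveD.
Qed.

Lemma ramp_0 x : x <= -1 -> ramp x = 0.
Proof.
by move=> x1; rewrite /ramp !pos_part_0; [ring|lra..].
Qed.

Lemma ramp_1 x : 1 <= x -> ramp x = 1.
Proof.
by move=> x1; rewrite /ramp !pos_part_id; [field|lra..].
Qed.

Lemma ramp_itv x : 0 <= ramp x <= 1.
Proof.
have [x1|/ltW x1] := leP x (-1); first by rewrite ramp_0// lexx ler01.
have [x2|/ltW x2] := leP 1 x; first by rewrite ramp_1// lexx ler01.
have e1 : pos_part (x + 1) = x + 1 by apply: pos_part_id; lra.
have e2 : pos_part (x - 1) = 0 by apply: pos_part_0; lra.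
rewrite /ramp e1 e2; have [x0|/ltW x0] := leP 0 x.
  by rewrite (pos_part_id x0); apply/andP; split; nra.
by rewrite (pos_part_0 x0); apply/andP; split; nra.
Qed.

Lemma tent_out x : ~ (-1 <= x <= 1) -> tent x = 0.
Proof.
move=> nx; rewrite /tent; have [x1|/ltW x1] := leP x (-1).
  by rewrite !pos_part_0; [ring|lra..].
have [x2|x2] := leP 1 x; first by rewrite !pos_part_id; [ring|lra..].
by case: nx; rewrite x1 ltW.
Qed.

Lemma tent_itv x : 0 <= tent x <= 1.
Proof.
have [xi|nx] := pselect (-1 <= x <= 1); last by rewrite tent_out// lexx ler01.
case/andP: xi => x1 x2.
have e1 : pos_part (x + 1) = x + 1 by apply: pos_part_id; lra.
have e2 : pos_part (x - 1) = 0 by apply: pos_part_0; lra.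
rewrite /tent e1 e2; have [x0|/ltW x0] := leP 0 x.
  by rewrite (pos_part_id x0); apply/andP; split; lra.
by rewrite (pos_part_0 x0); apply/andP; split; lra.
Qed.

End Ramp.

(** * Weak derivatives on the line *)

Section WeakDerivatives.
Context {R : realType}.
Notation mu := (@lebesgue_measure R).
Implicit Types f g k : R -> R.

Definition step (a h x : R) : R := ramp (h^-1 * (x - a)).
Definition kern (a h x : R) : R := h^-1 * tent (h^-1 * (x - a)).

Lemma is_derive_step (a h x : R) : is_derive x 1 (step a h) (kern a h x).
Proof.
have -> : step a h = fun y => ramp (- (h^-1 * a) + h^-1 * y).
  by apply/funext => y; rewrite /step; congr ramp; ring.
have -> : kern a h x = h^-1 * tent (- (h^-1 * a) + h^-1 * x).
  by rewrite /kern; congr (_ * tent _); ring.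
exact/is_derive_affine_arg/is_derive_ramp.
Qed.

Lemma continuous_kern (a h : R) : continuous (kern a h).
Proof.
move=> x; apply: cvgM; first exact: cvg_cst.
apply: continuous_cvg; first exact: continuous_tent.
by apply: cvgM; [exact: cvg_cst|apply: cvgB; [exact: cvg_id|exact: cvg_cst]].
Qed.

Lemma continuous_step (a h : R) : continuous (step a h).
Proof.
exact: (is_derive_continuous (is_derive_step a h)).
Qed.

Lemma step_0 (a h x : R) : 0 < h -> x <= a - h -> step a h x = 0.
Proof. by move=> h0 xa; apply: ramp_0; rewrite mulrC ler_pdivrMr//; lra. Qed.

Lemma step_1 (a h x : R) : 0 < h -> a + h <= x -> step a h x = 1.
Proof. by move=> h0 xa; apply: ramp_1; rewrite mulrC ler_pdivlMr//; lra. Qed.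

Lemma kern_out (a h x : R) : 0 < h -> ~ (a - h <= x <= a + h) -> kern a h x = 0.
Proof.
move=> h0 nx; rewrite /kern tent_out ?mulr0// => /andP[].
rewrite mulrC ler_pdivlMr// ler_pdivrMr// => x1 x2.
by apply: nx; apply/andP; split; lra.
Qed.

Lemma kern_itv (a h x : R) : 0 < h -> 0 <= kern a h x <= h^-1.
Proof.
move=> h0; have /andP[t0 t1] := tent_itv (h^-1 * (x - a)).
have h1 : 0 < h^-1 by rewrite invr_gt0.
by rewrite /kern mulr_ge0 ?(ltW h1)//= -[leRHS]mulr1 ler_wpM2l// ltW.
Qed.

Lemma interval_integrable_norm f : interval_integrable f ->
  interval_integrable (fun x => `|f x|).
Proof. by move=> fi a b; have := integrable_abse (fi a b). Qed.

Lemma le_norm_Rintegral_mul f k (B a b : R) : interval_integrable f -> continuous k ->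
  (forall x, `|k x| <= B) ->
  `|\int[mu]_(x in `[a, b]) (f x * k x)| <= B * \int[mu]_(x in `[a, b]) `|f x|.
Proof.
move=> fi ck kB; have fki := interval_integrableM fi ck.
have fn := interval_integrable_norm fi.
apply: le_trans (le_normr_Rintegral _ (fki a b)) _; first exact: measurable_itv.
rewrite mulrC -RintegralZr//.
have cB : continuous (fun _ : R => B) by exact: cst_continuous.
apply: le_Rintegral => //.
- exact: (interval_integrable_norm fki).
- exact: (interval_integrableM fn cB).
- by move=> x _; rewrite normrM ler_wpM2l.
Qed.

Lemma interval_integrableB f g : interval_integrable f ->
  interval_integrable g -> interval_integrable (fun x => f x - g x).
Proof.
move=> fi gi b c.
have -> : EFin \o (fun x => f x - g x) = ((EFin \o f) \- (EFin \o g))%E by [].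
by apply: integrableB; [exact: measurable_itv|exact: fi|exact: gi].
Qed.

Lemma interval_integrableD f g : interval_integrable f ->
  interval_integrable g -> interval_integrable (fun x => f x + g x).
Proof.
move=> fi gi b c.
have -> : EFin \o (fun x => f x + g x) = ((EFin \o f) \+ (EFin \o g))%E by [].
by apply: integrableD; [exact: measurable_itv|exact: fi|exact: gi].
Qed.

Lemma interval_integrable_cst (r : R) : interval_integrable (fun=> r).
Proof.
by apply: continuous_interval_integrable; exact: cst_continuous.
Qed.

Lemma lebesgue_pt_mean f (a e : R) : interval_integrable f -> lebesgue_pt f a ->
  0 < e -> exists2 d, 0 < d & forall h, 0 < h -> h < d ->
  \int[mu]_(x in `[a - h, a + h]) `|f x - f a| <= h * e.
Proof.
move=> fi /fine_cvgP[_ lf] e0; have e20 : 0 < e / 2 by rewrite divr_gt0.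
have [d /= d0 hd] := cvgr_lt _ lf _ e20.
exists d => // h h0 hlt.
have fci : interval_integrable (fun x => `|f x - f a|).
  apply: interval_integrable_norm; apply: interval_integrableB => //.
  exact: interval_integrable_cst.
have /= := hd h; rewrite sub0r normrN (gtr0_norm h0) => /(_ hlt h0).
rewrite /davg /iavg lebesgue_measure_ball ?(ltW h0)//.
have sub (i : interval R) : [set` i] `<=` `[a - h, a + h] ->
    mu.-integrable [set` i] (EFin \o (fun x => `|f x - f a|)).
  by move=> si; apply: integrableS (fci (a - h) (a + h)).
have -> : \int[mu]_(x in `[a - h, a + h]) `|f x - f a| =
    \int[mu]_(x in ball a h) `|f x - f a|.
  rewrite ball_itv -Rintegral_itv_obnd_cbnd; last first.
    by apply: sub => x /=; rewrite !in_itv/= => /andP[/ltW -> ->].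
  rewrite -Rintegral_itv_bndo_bndc//.
  by apply: sub => x /=; rewrite !in_itv/= => /andP[/ltW -> /ltW ->].
have fin : (\int[mu]_(y in ball a h) `|((center (f a) \o f) y)%:E| =
    (\int[mu]_(x in ball a h) `|f x - f a|)%R%:E)%E.
  rewrite /Rintegral ball_itv fineK//; apply: integrable_fin_num.
    exact: measurable_itv.
  apply: sub => x /=.
  by rewrite !in_itv/= => /andP[/ltW -> /ltW ->].
have h20 : h *+ 2 != 0 by rewrite mulrn_eq0/= gt_eqF.
rewrite fin inver (negbTE h20) -EFinM/= => /ltW.
rewrite ler_pdivrMl ?mulrn_wgt0//.
by have -> : h *+ 2 * (e / 2) = h * e by rewrite -[h *+ 2]mulr_natr; field.
Qed.

(** The kernels are averages on [[a - h, a + h]], bounded by [1 / h]. *)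
Lemma kern_mean f (a e : R) : interval_integrable f -> lebesgue_pt f a ->
  0 < e -> exists2 d, 0 < d & forall h, 0 < h -> h < d ->
  `|\int[mu]_x (f x * kern a h x) - f a| <= e.
Proof.
move=> fi fa e0; have [d d0 hd] := lebesgue_pt_mean fi fa e0.
exists d => // h h0 hlt.
have ck := @continuous_kern a h.
have fai := interval_integrable_cst (f a).
have fci := interval_integrableB fi fai.
rewrite (@Rintegral_support _ (fun x => f x * kern a h x) (a - h) (a + h)); last first.
  by move=> x nx; rewrite kern_out// mulr0.
have -> : f a = \int[mu]_(x in `[a - h, a + h]) (f a * kern a h x).
  rewrite RintegralZl//; last exact: continuous_interval_integrable.
  rewrite (Rintegral_derive _ ck (is_derive_step a h)); last by lra.
  by rewrite step_1// step_0// subr0 mulr1.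
rewrite -RintegralB//; [|exact: interval_integrableM|exact: interval_integrableM].
under eq_Rintegral do rewrite -mulrBl.
have kB x : `|kern a h x| <= h^-1.
  by have /andP[k0 k1] := kern_itv a x h0; rewrite ger0_norm.
apply: le_trans (le_norm_Rintegral_mul _ _ fci ck kB) _.
by rewrite ler_pdivrMl//; exact: hd.
Qed.

Lemma step_itv (a h x : R) : 0 <= step a h x <= 1.
Proof. exact: ramp_itv. Qed.

(** At a Lebesgue point of [|g|] its primitive is differentiable, hence
continuous. *)
Lemma primitive_norm_small g (s e : R) : interval_integrable g ->
  lebesgue_pt (fun x => `|g x|) s -> 0 < e -> exists2 d, 0 < d &
  forall x y, s - d < x -> x <= y -> y < s + d ->
    \int[mu]_(r in `[x, y]) `|g r| <= e.
Proof.
move=> gi gs e0; have gn := interval_integrable_norm gi.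
have [dG _] := is_derive_primitive gn gs.
have /differentiable_continuous cG : differentiable (primitive (fun x => `|g x|)) s.
  exact/derivable1_diffP.
have e20 : 0 < e / 2 by rewrite divr_gt0.
have /cvgrPdist_lt/(_ _ e20)/nbhs_ballP[d /= d0 hd] := cG.
exists d => // x y sx xy ys; rewrite -(primitiveB gn xy).
have near r : s - d < r -> r < s + d -> ball s d r.
  by move=> ? ?; rewrite -ball_normE/= ltr_norml; apply/andP; split; lra.
have xs : x < s + d by lra.
have sy : s - d < y by lra.
have := hd x (near x sx xs); have := hd y (near y sy ys); rewrite !ltr_norml.
by move=> /andP[? ?] /andP[? ?]; lra.
Qed.

(** The steps tend to the indicator of [[s, t]]: they differ only within [h] of
the ends, where little of [|g|] is integrated. *)
Lemma step_mean g (s t e : R) : interval_integrable g -> s < t ->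
  lebesgue_pt (fun x => `|g x|) s -> lebesgue_pt (fun x => `|g x|) t ->
  0 < e -> exists2 d, 0 < d & forall h, 0 < h -> h < d ->
  `|\int[mu]_x (g x * (step s h x - step t h x)) - \int[mu]_(x in `[s, t]) g x|
    <= e.
Proof.
move=> gi st gs gt e0; have e40 : 0 < e / 4 by rewrite divr_gt0.
have [d1 d10 h1] := primitive_norm_small gi gs e40.
have [d2 d20 h2] := primitive_norm_small gi gt e40.
exists (Num.min d1 (Num.min d2 ((t - s) / 2))).
  by rewrite !lt_min d10 d20 divr_gt0// subr_gt0.
move=> h h0; rewrite !lt_min => /andP[hd1 /andP[hd2 hts]].
pose phi x := step s h x - step t h x.
have cphi : continuous phi.
  by move=> x; apply: cvgB; exact: continuous_step.
have phiB x : `|phi x| <= 1.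
  have /andP[? ?] := step_itv s h x; have /andP[? ?] := step_itv t h x.
  by rewrite ler_norml /phi; apply/andP; split; lra.
have gphi := interval_integrableM gi cphi.
have g1 x y : `|\int[mu]_(r in `[x, y]) g r| <= \int[mu]_(r in `[x, y]) `|g r|.
  by apply: le_normr_Rintegral => //; exact: gi.
have g2 x y : `|\int[mu]_(r in `[x, y]) (g r * phi r)| <=
    \int[mu]_(r in `[x, y]) `|g r|.
  by rewrite -[leRHS]mul1r; exact: le_norm_Rintegral_mul.
rewrite (@Rintegral_support _ (fun x => g x * (step s h x - step t h x))
  (s - h) (t + h)); last first.
  move=> x nx; have [xs|sx] := leP x (s - h).
    by rewrite !step_0 ?subrr ?mulr0//; lra.
  have [tx|xt] := leP (t + h) x.
    by rewrite !step_1 ?subrr ?mulr0//; lra.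
  by case: nx; rewrite !ltW.
rewrite -/phi (@Rintegral_chasles _ _ (s - h) (s + h)) //; [|lra..].
rewrite (@Rintegral_chasles _ _ (s + h) (t - h)) //; [|lra..].
have -> : \int[mu]_(x in `[s + h, t - h]) (g x * phi x) =
    \int[mu]_(x in `[s + h, t - h]) g x.
  apply: eq_Rintegral => x; rewrite inE/= in_itv/= => /andP[x1 x2].
  by rewrite /phi step_1// step_0// subr0 mulr1.
rewrite (@Rintegral_chasles _ g s (s + h) t) //; [|lra..].
rewrite (@Rintegral_chasles _ g (s + h) (t - h) t) //; [|lra..].
have k1 : `|\int[mu]_(r in `[s - h, s + h]) (g r * phi r)| <= e / 4.
  by apply: (le_trans (g2 _ _)); apply: h1; lra.
have k2 : `|\int[mu]_(r in `[t - h, t + h]) (g r * phi r)| <= e / 4.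
  by apply: (le_trans (g2 _ _)); apply: h2; lra.
have k3 : `|\int[mu]_(r in `[s, s + h]) g r| <= e / 4.
  by apply: (le_trans (g1 _ _)); apply: h1; lra.
have k4 : `|\int[mu]_(r in `[t - h, t]) g r| <= e / 4.
  by apply: (le_trans (g1 _ _)); apply: h2; lra.
move: k1 k2 k3 k4; rewrite !ler_norml.
move=> /andP[? ?] /andP[? ?] /andP[? ?] /andP[? ?].
by apply/andP; split; lra.
Qed.

Lemma test_function_step (s t h : R) : s < t -> 0 < h ->
  test_function (fun x => step s h x - step t h x) /\
  (derive1 (fun x => step s h x - step t h x) =
    (fun x => kern s h x - kern t h x)).
Proof.
move=> st h0.
have d (x : R) : is_derive x 1 (fun x => step s h x - step t h x)
    (kern s h x - kern t h x).
  have d1 := is_derive_step s h x; have d2 := is_derive_step t h x.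
  have -> : (fun x => step s h x - step t h x) = step s h - step t h by [].
  exact: is_deriveB.
have e : derive1 (fun x => step s h x - step t h x) =
    (fun x => kern s h x - kern t h x).
  by apply/funext => x; rewrite derive1E; have [] := d x.
split => //; split.
- by move=> x; have [] := d x.
- by rewrite e => x; apply: cvgB; exact: continuous_kern.
- apply: (subclosed_compact _ (@segment_compact R (s - h) (t + h))).
    exact: closed_closure.
  have /closure_id -> : closed `[s - h, t + h]%classic by exact: itv_closed.
  apply: closureS => x /=; rewrite in_itv/=; apply: contraNT; rewrite negb_and -!ltNge.
  move=> /orP[xs|tx].
    by rewrite !step_0 ?subrr//; lra.
  by rewrite !step_1 ?subrr//; lra.
Qed.

(** Testing against smooth steps from [s] to [t]: at Lebesgue points the weak
derivative computes the increments. *)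
Lemma weak_increment f g (s t : R) :
  interval_integrable f -> interval_integrable g ->
  (forall phi, test_function phi ->
    \int[mu]_x (f x * derive1 phi x) = - \int[mu]_x (g x * phi x)) ->
  lebesgue_pt f s -> lebesgue_pt f t ->
  lebesgue_pt (fun x => `|g x|) s -> lebesgue_pt (fun x => `|g x|) t -> s < t ->
  f t - f s = \int[mu]_(x in `[s, t]) g x.
Proof.
move=> fi gi weak fs ft gs gt st.
apply/eqP; rewrite -subr_eq0 -normr_le0; apply/ler_addgt0Pr => e e0; rewrite add0r.
have e30 : 0 < e / 3 by rewrite divr_gt0.
have [d1 d10 h1] := kern_mean fi fs e30.
have [d2 d20 h2] := kern_mean fi ft e30.
have [d3 d30 h3] := step_mean gi st gs gt e30.
pose h := Num.min d1 (Num.min d2 d3) / 2.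
have m0 : 0 < Num.min d1 (Num.min d2 d3) by rewrite !lt_min d10 d20.
have h0 : 0 < h by rewrite divr_gt0.
have hm : h < Num.min d1 (Num.min d2 d3) by rewrite /h; lra.
move: hm; rewrite !lt_min => /andP[hd1 /andP[hd2 hd3]].
have [tf te] := test_function_step st h0.
have := weak _ tf; rewrite te => W.
have k1 := h1 h h0 hd1; have k2 := h2 h h0 hd2; have k3 := h3 h h0 hd3.
have Wl : \int[mu]_x (f x * (kern s h x - kern t h x)) =
    \int[mu]_x (f x * kern s h x) - \int[mu]_x (f x * kern t h x).
  have sup a F : F = (fun x => f x * kern a h x) -> s <= a <= t ->
      \int[mu]_x F x = \int[mu]_(x in `[s - h, t + h]) F x.
    move=> -> /andP[sa at_]; apply: Rintegral_support => x nx.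
    rewrite kern_out ?mulr0// => /andP[x1 x2]; apply: nx.
    by apply/andP; split; lra.
  rewrite (sup s _ erefl) ?lexx ?ltW// (sup t _ erefl) ?lexx ?ltW//.
  rewrite -RintegralB//;
    [|by apply: interval_integrableM => //; exact: continuous_kern..].
  rewrite (@Rintegral_support _ _ (s - h) (t + h)).
    by apply: eq_Rintegral => x _; rewrite mulrBr.
  move=> x nx; rewrite !kern_out ?subrr ?mulr0// => /andP[x1 x2]; apply: nx;
  by apply/andP; split; lra.
rewrite Wl in W; move: k1 k2 k3; rewrite !ler_norml.
move=> /andP[? ?] /andP[? ?] /andP[? ?].
by apply/andP; split; lra.
Qed.

End WeakDerivatives.

Section AlmostEverywhere.
Context {R : realType}.
Notation mu := (@lebesgue_measure R).
Implicit Types f g : R -> R.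

Lemma aeW2 (P Q S : R -> Prop) : (forall x, P x -> Q x -> S x) ->
  {ae mu, forall x, P x} -> {ae mu, forall x, Q x} -> {ae mu, forall x, S x}.
Proof.
move=> PQS aeP aeQ; apply: negligibleS (negligibleU aeP aeQ) => x /= nS.
have [Px|nP] := pselect (P x); last by left.
by right => Qx; apply: nS; exact: PQS.
Qed.

Lemma ae_dense (P : R -> Prop) (a b : R) : {ae mu, forall x, P x} -> a < b ->
  exists2 x, a < x < b & P x.
Proof.
move=> [M [mM M0 PM]] ab; apply: contrapT => /forall2NP nP.
have sub : `]a, b[%classic `<=` M.
  move=> x /=; rewrite in_itv/= => xab; apply: PM => Px.
  by case: (nP x).
have h : (mu `]a, b[%classic <= mu M)%E.
  by apply: le_measure; rewrite ?inE//; exact: measurable_itv.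
move: h; rewrite M0 lebesgue_measure_itv/= lte_fin ab -EFinD lee_fin leNgt subr_gt0.
by rewrite ab.
Qed.

Lemma locally_integrable_interval f : locally_integrable setT f ->
  interval_integrable f.
Proof.
move=> [mf _ fi] a b; apply/integrableP; split.
  by apply/measurable_EFinP; apply: measurable_funTS.
by under eq_integral do rewrite /= ; apply: fi => //; exact: segment_compact.
Qed.

Lemma locally_integrable_norm f : locally_integrable setT f ->
  locally_integrable setT (fun x => `|f x|).
Proof.
move=> [mf oT fi]; split => //; first exact: measurableT_comp.
by move=> K KT cK; under eq_integral do rewrite normr_id; exact: fi.
Qed.

(** The absolutely continuous representative of a function with a weak
derivative. *)
Lemma weak_derivative_primitive f g :
  locally_integrable setT f -> locally_integrable setT g ->
  (forall phi, test_function phi ->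
    \int[mu]_x (f x * derive1 phi x) = - \int[mu]_x (g x * phi x)) ->
  exists c, {ae mu, forall x, f x = c + primitive g x}.
Proof.
move=> lf lg weak.
have fi := locally_integrable_interval lf.
have gi := locally_integrable_interval lg.
have aeA : {ae mu, forall x, lebesgue_pt f x /\ lebesgue_pt (fun x => `|g x|) x}.
  have h1 := lebesgue_differentiation lf.
  have h2 := lebesgue_differentiation (locally_integrable_norm lg).
  by apply: aeW2 h1 h2.
have [x0 _ [fx0 gx0]] := ae_dense aeA ltr01.
exists (f x0 - primitive g x0); apply: (aeW2 _ aeA aeA) => x [fx gx] _.
have [xx0|x0x|->] := ltgtP x x0; last by rewrite subrK.
  have := weak_increment fi gi weak fx fx0 gx gx0 xx0.
  by rewrite -primitiveB ?(ltW xx0)//; lra.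
have := weak_increment fi gi weak fx0 fx gx0 gx x0x.
by rewrite -primitiveB ?(ltW x0x)//; lra.
Qed.

(** The classical and the weak derivative have primitives that differ by a
constant on a dense set; the difference quotients along that set vanish. *)
Lemma weak_derivative_classical f f' g :
  locally_integrable setT f -> locally_integrable setT g ->
  (forall phi, test_function phi ->
    \int[mu]_x (f x * derive1 phi x) = - \int[mu]_x (g x * phi x)) ->
  (forall x : R, is_derive x 1 f (f' x)) -> {ae mu, forall x, g x = f' x}.
Proof.
move=> lf lg weak df.
have gi := locally_integrable_interval lg.
have [c aec] := weak_derivative_primitive lf lg weak.
have aeg := lebesgue_differentiation lg.
apply: (aeW2 _ aec aeg) => x fx gx.
have dG := is_derive_primitive gi gx.
have [dD eD] : is_derive x 1 (f - primitive g) (f' x - g x).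
  by apply: is_deriveB.
apply/eqP; rewrite -subr_eq0 -normr_le0; apply/ler_addgt0Pr => e e0; rewrite add0r.
have lim : h^-1 *: (((f - primitive g) \o shift x) (h *: (1 : R)) -
    (f - primitive g) x) @[h --> 0^'] --> f' x - g x.
  by rewrite -eD; exact: dD.
have /cvgrPdist_lt/(_ e e0)/nbhs_ballP[d /= d0 hd] := lim.
have xd : x < x + d by rewrite ltrDl.
have [y /andP[xy yd] fy] := ae_dense aec xd.
have b1 : ball 0 d (y - x).
  by rewrite -ball_normE/= sub0r normrN ger0_norm; lra.
have n0 : y - x != 0 by rewrite subr_eq0 gt_eqF.
have := hd (y - x) b1 n0; rewrite /= [(y - x) *: 1]mulr1 subrK.
have -> : (f - primitive g) y = c by change (f y - primitive g y = c); rewrite fy addrK.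
have -> : (f - primitive g) x = c by change (f x - primitive g x = c); rewrite fx addrK.
by rewrite subrr scaler0 subr0 distrC => /ltW.
Qed.

(** The integral of nonnegative functions is a supremum over simple functions, so
it is monotone without any measurability. *)
Lemma ge0_le_integral_any (f g : R -> \bar R) :
  (forall x, 0 <= f x)%E -> (forall x, f x <= g x)%E ->
  (\int[mu]_x f x <= \int[mu]_x g x)%E.
Proof.
move=> f0 fg; rewrite !ge0_integralTE//; last first.
  by move=> x; exact: le_trans (f0 x) (fg x).
apply: le_ereal_sup => _ [h hf <-]; exists h => // x.
exact: le_trans (hf x) (fg x).
Qed.

Lemma interval_RintegralB f g a b : interval_integrable f ->
  interval_integrable g -> \int[mu]_(x in `[a, b]) (f x - g x) =
  \int[mu]_(x in `[a, b]) f x - \int[mu]_(x in `[a, b]) g x.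
Proof. by move=> fi gi; rewrite RintegralB. Qed.

Lemma interval_RintegralZr f c a b : interval_integrable f ->
  \int[mu]_(x in `[a, b]) (f x * c) = \int[mu]_(x in `[a, b]) f x * c.
Proof. by move=> fi; rewrite RintegralZr. Qed.

(** Cauchy-Schwarz, from the variance of [g] around its mean. *)
Lemma sqr_Rintegral_le g s t : interval_integrable g ->
  interval_integrable (fun x => g x ^+ 2) -> s <= t ->
  (\int[mu]_(x in `[s, t]) g x) ^+ 2 <=
  (t - s) * \int[mu]_(x in `[s, t]) g x ^+ 2.
Proof.
move=> gi g2i; rewrite le_eqVlt => /predU1P[->|st].
  by rewrite set_itv1 !Rintegral_set1 expr0n/= mulr0.
have ts0 : 0 < t - s by rewrite subr_gt0.
set G := \int[mu]_(x in _) g x; set G2 := \int[mu]_(x in _) _ ^+ 2.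
pose c := G / (t - s).
have cgi : interval_integrable (fun x => g x * (2 * c)).
  by apply: interval_integrableM => //; exact: cst_continuous.
have : 0 <= \int[mu]_(x in `[s, t]) ((g x ^+ 2 - g x * (2 * c)) - (- c ^+ 2)).
  by apply: Rintegral_ge0 => x _; have := sqr_ge0 (g x - c); lra.
have i1 := interval_integrableB g2i cgi.
have i2 := interval_integrable_cst (- c ^+ 2).
rewrite (interval_RintegralB _ _ i1 i2) (interval_RintegralB _ _ g2i cgi).
rewrite (interval_RintegralZr _ _ _ gi).
rewrite Rintegral_cst//= lebesgue_measure_itv/= lte_fin st/= -/G -/G2.
have -> : G2 - G * (2 * c) - - c ^+ 2 * (t - s) = G2 - G ^+ 2 / (t - s).
  by rewrite /c; field; rewrite gt_eqF.
by rewrite subr_ge0 ler_pdivrMr// mulrC.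
Qed.

End AlmostEverywhere.

(** * Curves in H1loc *)

Section SobolevCurves.
Context {R : realType} {N : nat}.
Notation mu := (@lebesgue_measure R).
Implicit Types V g : R -> 'rV[R]_N.

Lemma locally_integrable_le (f g : R -> R) : measurable_fun setT f ->
  locally_integrable setT g -> (forall x, `|f x| <= `|g x|) ->
  locally_integrable setT f.
Proof.
move=> mf [mg oT gi] fg; split => // K KT cK.
apply: le_lt_trans (gi K KT cK); apply: ge0_le_integral.
- exact: compact_measurable.
- by move=> x _; rewrite lee_fin.
- by apply/measurable_EFinP; apply: measurableT_comp => //; exact: measurable_funTS.
- by apply/measurable_EFinP; apply: measurableT_comp => //; exact: measurable_funTS.
- by move=> x _; rewrite lee_fin.
Qed.

Lemma L2loc_L1loc V : L2loc V -> L1loc V.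
Proof.
move=> [mV lV] i.
apply: (locally_integrable_le (mV i) (locally_integrableD
  (locally_integrable_indic openT measurableT) lV)) => x.
rewrite /= indicE in_setT enorm_sqr.
have S0 := sqn_ge0 (V x); have S1 := sqn_coord (V x) i.
rewrite [leRHS]ger0_norm ?addr_ge0//.
have e2 : `|V x 0 i| ^+ 2 = V x 0 i ^+ 2 by rewrite real_normK ?num_real.
rewrite -e2 in S1.
have ar (A B : R) : A ^+ 2 <= B -> 0 <= A -> A <= 1 + B.
  by move=> h1 h2; have := sqr_ge0 (A - 1); rewrite sqrrB1; lra.
by apply: ar; [exact: S1|exact: normr_ge0].
Qed.

Lemma measurable_sqn g : (forall i, measurable_fun setT (fun x => g x 0 i)) ->
  measurable_fun setT (fun x => sqn (g x)).
Proof.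
move=> mg; apply: measurable_sum => i.
exact: (measurable_funX 2 (mg i)).
Qed.

Lemma ae_forall_ord (P : 'I_N -> R -> Prop) :
  (forall i, {ae mu, forall x, P i x}) -> {ae mu, forall x, forall i, P i x}.
Proof.
move=> h; pose F (k : nat) := if insub k is Some i then ~` [set x | P i x] else set0.
have : mu.-negligible (\bigcup_k F k).
  apply: negligible_bigcup => k; rewrite /F.
  case: insubP => [i _ _|_]; first exact: h.
  exact: negligible_set0.
apply: negligibleS => x /= /existsNP[i nP]; exists (nat_of_ord i) => //.
by rewrite /F valK.
Qed.

Lemma interval_integrable_le (f g : R -> R) : measurable_fun setT f ->
  interval_integrable g -> (forall x, `|f x| <= `|g x|) -> interval_integrable f.
Proof.
move=> mf gi fg a b; apply: le_integrable (gi a b) => //.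
  by apply/measurable_EFinP; exact: measurable_funTS.
by move=> x _; rewrite lee_fin.
Qed.

Lemma integrable_interval (f : R -> R) : measurable_fun setT f ->
  (forall x, 0 <= f x) -> (\int[mu]_x (f x)%:E < +oo)%E -> interval_integrable f.
Proof.
move=> mf f0 fi a b; have h : mu.-integrable setT (EFin \o f).
  apply/integrableP; split; first exact/measurable_EFinP.
  by under eq_integral do rewrite /= ger0_norm//.
by apply: integrableS h.
Qed.

Lemma Rintegral_le_total (f : R -> R) (M : R) s t : measurable_fun setT f ->
  (forall x, 0 <= f x) -> (\int[mu]_x (f x)%:E <= M%:E)%E ->
  \int[mu]_(x in `[s, t]) f x <= M.
Proof.
move=> mf f0 fM.
have fi : interval_integrable f.
  by apply: integrable_interval => //; apply: le_lt_trans fM _; exact: ltry.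
rewrite -lee_fin; apply: le_trans fM.
rewrite /Rintegral fineK; last by apply: integrable_fin_num => //; exact: fi.
apply: ge0_subset_integral => //.
  exact/measurable_EFinP.
by move=> x _; rewrite lee_fin.
Qed.

Lemma sqn_Rintegral_le g (V : R -> 'rV[R]_N) s t : s <= t ->
  (forall i, interval_integrable (fun x => g x 0 i)) ->
  interval_integrable (fun x => sqn (g x)) ->
  (forall i, measurable_fun setT (fun x => g x 0 i)) ->
  (forall i, V t 0 i - V s 0 i = \int[mu]_(x in `[s, t]) g x 0 i) ->
  sqn (V t - V s) <= (t - s) * \int[mu]_(x in `[s, t]) sqn (g x).
Proof.
move=> st gi g2i mg Vg.
have g2 i : interval_integrable (fun x => g x 0 i ^+ 2).
  apply: interval_integrable_le g2i _ => [|x]; first exact: (measurable_funX 2 (mg i)).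
  by rewrite !ger0_norm ?sqr_ge0 ?sqn_ge0// sqn_coord.
have -> : \int[mu]_(x in `[s, t]) sqn (g x) =
    \sum_(i < N) \int[mu]_(x in `[s, t]) g x 0 i ^+ 2.
  suff h (r : seq 'I_N) :
      interval_integrable (fun x => \sum_(i <- r) g x 0 i ^+ 2) /\
      \int[mu]_(x in `[s, t]) \sum_(i <- r) g x 0 i ^+ 2 =
      \sum_(i <- r) \int[mu]_(x in `[s, t]) g x 0 i ^+ 2 by exact: (h _).2.
  elim: r => [|i r [ihi ihe]].
    split.
      have -> : (fun x => \sum_(i <- [::]) g x 0 i ^+ 2) = (fun=> 0).
        by apply/funext => x; rewrite big_nil.
      exact: interval_integrable_cst.
    rewrite big_nil; under eq_Rintegral do rewrite big_nil.
    by rewrite Rintegral_cst// mul0r.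
  have -> : (fun x => \sum_(j <- i :: r) g x 0 j ^+ 2) =
      (fun x => g x 0 i ^+ 2 + \sum_(j <- r) g x 0 j ^+ 2).
    by apply/funext => x; rewrite big_cons.
  split; last first.
    rewrite big_cons -ihe.
    by rewrite RintegralD//; exact: g2.
  exact: interval_integrableD.
rewrite mulr_sumr; apply: ler_sum => i _; rewrite !mxE Vg.
exact: sqr_Rintegral_le.
Qed.

End SobolevCurves.

Section LowerBound.
Context {R : realType} {N : nat} {W : 'rV[R]_N -> R} {a b : 'rV[R]_N}.
Notation mu := (@lebesgue_measure R).
Hypothesis W_ge0 : forall x, 0 <= W x.
Hypothesis W_cont : continuous W.

Lemma weak_derivativeP (V g : R -> 'rV[R]_N) : is_weak_derivative V g ->
  is_weak_derivative V (weak_derivative V).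
Proof.
move=> hg; rewrite /weak_derivative.
by apply: (@xgetPex _ (fun=> 0) [set g | is_weak_derivative V g]); exists g.
Qed.

Lemma H_energyE (V : R -> 'rV[R]_N) : H_energy W V =
  (\int[mu]_x (2^-1 * sqn (weak_derivative V x) + W (V x))%:E)%E.
Proof. by apply: eq_integral => x _; rewrite enorm_sqr. Qed.

Lemma continuous_comp_curve (u : R -> 'rV[R]_N) : continuous u ->
  continuous (fun x => W (u x)).
Proof.
by move=> cu x; exact: (continuous_cvg _ (@W_cont (u x)) (cu x)).
Qed.

Lemma potential_profile_primitive (u : R -> 'rV[R]_N) : continuous u ->
  potential_profile W setT u (primitive (fun x => W (u x))).
Proof.
move=> cu s t w _ _ st hw.
have [c cst ->] := mvt_increment st
  (fun x => is_derive_primitive_continuous x (continuous_comp_curve cu)).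
by apply: ler_wpM2r; [rewrite subr_ge0|exact: hw].
Qed.

(** Values of a continuous representative are approximated by values of the
function at nearby later times. *)
Lemma ae_eq_approx (V u : R -> 'rV[R]_N) t (e d : R) : continuous u ->
  {ae mu, forall x, V x = u x} -> 0 < e -> 0 < d ->
  exists2 s, t < s < t + d & forall z, sqn (V s - z) < e / 4 -> sqn (u t - z) < e.
Proof.
move=> cu Vu e0 d0; have e40 : 0 < e / 4 by rewrite divr_gt0.
have cut : u s @[s --> t] --> u t := cu t.
have : \forall s \near t, sqn (u s - u t) < e / 4.
  by move/sqn_cvgP : cut; exact.
move=> /nbhs_ballP[d1 /= d10 hd].
have td : t < t + Num.min d d1 by rewrite ltrDl lt_min d0.
have [s /andP[ts std] Vs] := ae_dense Vu td.
have m1 : Num.min d d1 <= d by rewrite ge_min lexx.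
have m2 : Num.min d d1 <= d1 by rewrite ge_min lexx orbT.
exists s; first by rewrite ts/=; lra.
move=> z; rewrite Vs => hz.
have hs : sqn (u s - u t) < e / 4.
  by apply: hd; rewrite -ball_normE/= ltr_norml; apply/andP; split; lra.
have := sqnD_le2 (u t - u s) (u s - z); rewrite addrA subrK (sqnB (u t)).
lra.
Qed.

(** The absolutely continuous representative of [V], with the partial integrals
of its energy as profiles.  Its energy is bounded by that of [V] through a
pointwise inequality of the integrands off a null set, so that only its own
density has to be measurable. *)
Theorem H1loc_admissible (V : R -> 'rV[R]_N) : H1loc V -> connects a b V ->
  (H_energy W V < +oo)%E ->
  exists u q p, admissible W a b (fine (H_energy W V)) u q p.
Proof.
move=> hV [Va Vb]; rewrite H_energyE; set g := weak_derivative V.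
set H := (\int[mu]_x _)%E => Hoo.
have [lg weak] : is_weak_derivative V g.
  by have [_ [g' _ hg']] := hV; exact: weak_derivativeP hg'.
have lV := L2loc_L1loc hV.1.
have mg i : measurable_fun setT (fun x => g x 0 i) by case: (lg i).
have gi i : interval_integrable (fun x => g x 0 i).
  exact: locally_integrable_interval (lg i).
have H0 : (0 <= H)%E.
  apply: integral_ge0 => x _; rewrite lee_fin addr_ge0// mulr_ge0 ?sqn_ge0//.
have Hfin : H \is a fin_num by rewrite ge0_fin_numE.
set M := fine H; have HM : H = M%:E by rewrite /M fineK.
have /choice[c hc] : forall i, exists c : R,
    {ae mu, forall x, V x 0 i = c + primitive (fun x => g x 0 i) x}.
  move=> i; apply: weak_derivative_primitive (lV i) (lg i) _ => phi.
  exact: weak.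
pose u x : 'rV[R]_N := \row_i (c i + primitive (fun x => g x 0 i) x).
have Vu : {ae mu, forall x, V x = u x}.
  have h := ae_forall_ord hc; apply: (aeW2 _ h h) => x hx _.
  by apply/rowP => i; rewrite hx mxE.
have [Z [mZ Z0 VuZ]] := Vu.
pose k x := 2^-1 * sqn (g x).
have k0 x : 0 <= k x by rewrite mulr_ge0 ?sqn_ge0.
have mk : measurable_fun setT k.
  by apply: measurable_funM => //; exact: measurable_sqn.
have kM : (\int[mu]_x (k x)%:E <= M%:E)%E.
  rewrite -HM; apply: ge0_le_integral_any => x; rewrite lee_fin//.
  by rewrite lerDl.
have ki : interval_integrable k.
  by apply: integrable_interval => //; apply: le_lt_trans kM _; exact: ltry.
have si : interval_integrable (fun x => sqn (g x)).
  have -> : (fun x => sqn (g x)) = (fun x => k x * 2).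
    by apply/funext => x; rewrite /k mulrAC mulVf// mul1r.
  by apply: interval_integrableM => //; exact: cst_continuous.
have kin : kinetic_profile setT u (primitive k).
  move=> s t _ _ st.
  have h := @sqn_Rintegral_le R N g u s t st gi si mg _.
  have {}h : sqn (u t - u s) <= (t - s) * \int[mu]_(x in `[s, t]) sqn (g x).
    apply: h => i; rewrite !mxE -primitiveB//.
    by rewrite opprD addrACA subrr add0r.
  apply: (le_trans h); rewrite primitiveB//.
  have -> : \int[mu]_(x in `[s, t]) k x = 2^-1 * \int[mu]_(x in `[s, t]) sqn (g x).
    by rewrite RintegralZl//; exact: si.
  set J := \int[mu]_(x in _) _.
  by have -> : 2 * (t - s) * (2^-1 * J) = (t - s) * J by field.
have cu : continuous u.
  have kB s t : s <= t -> primitive k t - primitive k s <= M.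
    by move=> st; rewrite primitiveB//; exact: Rintegral_le_total.
  move=> t; apply/sqn_cvgP => e e0.
  exact: holder_cvg e0 (kinetic_holder kin kB).
pose f x := k x + W (u x).
have cW := continuous_comp_curve cu.
have mf : measurable_fun setT f.
  by apply: measurable_funD => //; exact: continuous_measurable_fun.
have f0 x : 0 <= f x by rewrite addr_ge0.
have fM : (\int[mu]_x (f x)%:E <= M%:E)%E.
  have -> : (\int[mu]_x (f x)%:E = \int[mu]_x (f x * \1_(~` Z) x)%:E)%E.
    apply: ge0_ae_eq_integral => //.
    - exact/measurable_EFinP.
    - apply/measurable_EFinP; apply: measurable_funM => //.
      by apply: measurable_indic; exact: measurableC.
    - by move=> x _; rewrite lee_fin.
    - by move=> x _; rewrite lee_fin mulr_ge0.
    - exists Z; split => // x /= nx; apply: contrapT => nZ; apply: nx => _.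
      by rewrite indicE mem_set// mulr1.
  rewrite -HM; apply: ge0_le_integral_any => x; rewrite lee_fin.
    by rewrite mulr_ge0.
  have [Zx|nZ] := pselect (Z x).
    by rewrite indicE memNset ?mulr0 ?addr_ge0 ?k0//; exact/contrapT.
  rewrite indicE mem_set// mulr1 /f; have -> : V x = u x.
    by apply: contrapT => nV; apply: nZ; exact: VuZ.
  exact: lexx.
exists u, (primitive k), (primitive (fun x => W (u x))); split.
- by split => //; exact: potential_profile_primitive.
- move=> e e0; have e40 : 0 < e / 4 by rewrite divr_gt0.
  have [T hT] := cvg_tends_Ny Va e40; exists (T - 1) => t tT.
  have [s /andP[_ st1]] := ae_eq_approx t cu Vu e0 ltr01.
  by apply; apply: hT; lra.
- move=> e e0; have e40 : 0 < e / 4 by rewrite divr_gt0.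
  have [T hT] := cvg_tends_y Vb e40; exists T => t tT.
  have [s /andP[ts _]] := ae_eq_approx t cu Vu e0 ltr01.
  by apply; apply: hT; lra.
move=> s t st.
have e1 := primitiveB ki st.
have e2 := primitiveB (continuous_interval_integrable cW) st.
have e3 : \int[mu]_(x in `[s, t]) f x <= M by exact: Rintegral_le_total.
rewrite RintegralD// in e3; last exact: continuous_interval_integrable.
by rewrite -e1 -e2 in e3; lra.
Qed.

End LowerBound.

(** * The energy of a C1 curve with profiles *)

Section EnergyUpperBound.
Context {R : realType} {N : nat} {W : 'rV[R]_N -> R}.
Notation mu := (@lebesgue_measure R).
Hypothesis W_ge0 : forall x, 0 <= W x.
Hypothesis W_cont : continuous W.

Lemma test_function_support (phi : R -> R) : test_function phi ->
  exists2 A, 0 < A & forall x, ~ (- A < x < A) -> phi x = 0 /\ derive1 phi x = 0.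
Proof.
move=> [dphi cphi /compact_bounded[B [_ hB]]].
pose M := `|B| + 1; have BM : B < M by rewrite (le_lt_trans (ler_norm _))// ltrDl.
have out x : M < `|x| -> phi x = 0.
  move=> Mx; apply: contrapT => /eqP px.
  have cx : closure [set x | phi x != 0] x by apply: subset_closure.
  have := hB M BM x cx; rewrite /= => xM.
  by move: (lt_le_trans Mx xM); rewrite ltxx.
exists (M + 1) => [|x nx]; first by rewrite /M -addrA ltr_wpDl.
have Mx : M < `|x|.
  rewrite ltNge; apply/negP; rewrite ler_norml => /andP[? ?].
  by apply: nx; apply/andP; split; lra.
split; first exact: out.
rewrite derive1E (@near_eq_derive _ _ _ phi (cst 0)) ?derive_cst//.
have : \forall y \near x, M < `|y|.
  exact: (cvgr_gt _ (@norm_continuous _ R x)).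
by apply: filterS => y; exact: out.
Qed.

Lemma classical_weak_derivative (f f' phi : R -> R) : continuous f' ->
  (forall x : R, is_derive x 1 f (f' x)) -> test_function phi ->
  \int[mu]_x (f x * derive1 phi x) = - \int[mu]_x (f' x * phi x).
Proof.
move=> cf' df tphi; have [A A0 hA] := test_function_support tphi.
have [dphi cphi _] := tphi.
have AA : - A <= A by lra.
have out x : ~ (- A <= x <= A) -> phi x = 0 /\ derive1 phi x = 0.
  move=> nx; apply: hA => /andP[x1 x2]; apply: nx.
  by rewrite !ltW.
rewrite (@Rintegral_support _ (fun x => f x * derive1 phi x) (- A) A); last first.
  by move=> x /out[_ ->]; rewrite mulr0.
rewrite (@Rintegral_support _ (fun x => f' x * phi x) (- A) A); last first.
  by move=> x /out[-> _]; rewrite mulr0.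
have dp (x : R) : is_derive x 1 phi (derive1 phi x).
  by rewrite derive1E; apply: DeriveDef; first exact: dphi.
have cf := is_derive_continuous df; have cp := is_derive_continuous dp.
have i1 : interval_integrable (fun x => f x * derive1 phi x).
  by apply: interval_integrableM => //; exact: continuous_interval_integrable.
have i2 : interval_integrable (fun x => f' x * phi x).
  by apply: interval_integrableM => //; exact: continuous_interval_integrable.
have dfp (x : R) : is_derive x 1 (f * phi) (f x * derive1 phi x + f' x * phi x).
  by rewrite [f' x * _]mulrC; apply: is_deriveM.
have cfp : continuous (fun x => f x * derive1 phi x + f' x * phi x).
  move=> x; apply: cvgD; first by apply: cvgM; [exact: cf|exact: cphi].
  by apply: cvgM; [exact: cf'|exact: cp].
have := Rintegral_derive AA cfp dfp.
rewrite RintegralD//.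
have z1 : phi A = 0 by apply: (hA _ _).1; rewrite ltxx andbF.
have z2 : phi (- A) = 0 by apply: (hA _ _).1; rewrite ltxx.
have -> : (f * phi) A = 0 by change (f A * phi A = 0); rewrite z1 mulr0.
have -> : (f * phi) (- A) = 0 by change (f (- A) * phi (- A) = 0); rewrite z2 mulr0.
by rewrite subrr => /eqP; rewrite addr_eq0 => /eqP.
Qed.

Lemma continuous_locally_integrable (f : R -> R) : continuous f ->
  locally_integrable setT f.
Proof.
move=> cf; split; [exact: continuous_measurable_fun|exact: openT|].
move=> K _ cK.
have /integrableP[_] : mu.-integrable K (EFin \o f).
  by apply: continuous_compact_integrable => //; exact: continuous_subspaceT.
by under eq_integral do rewrite /=.
Qed.

(** The weak derivative is the classical one almost everywhere, and the integrals
over [[-n, n]] are bounded by increments of the profiles. *)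
Lemma H_energy_classical_le (u u1 : R -> 'rV[R]_N) (q p : R -> R) (m : R) :
  (forall (t : R) i, is_derive t 1 (fun s => u s 0 i) (u1 t 0 i)) ->
  continuous u -> continuous u1 ->
  profile W setT u q p -> energy_le m q p -> (H_energy W u <= m%:E)%E.
Proof.
move=> du cu cu1 [kin pot] E.
have lu i := continuous_locally_integrable (continuous_coord (i := i) cu).
have lu1 i := continuous_locally_integrable (continuous_coord (i := i) cu1).
have w1 : is_weak_derivative u u1.
  split=> // phi i tphi.
  by apply: classical_weak_derivative => //; exact: continuous_coord.
have [lg weak] := weak_derivativeP w1.
set g := weak_derivative u in lg weak.
have gu : {ae mu, forall x i, g x 0 i = u1 x 0 i}.
  apply: ae_forall_ord => i.
  apply: (weak_derivative_classical (lu i) (lg i)) => // phi tphi.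
  exact: weak.
have mW : measurable_fun setT (fun x => W (u x)).
  by apply: continuous_measurable_fun; exact: continuous_comp_curve.
pose h x := 2^-1 * sqn (u1 x) + W (u x).
have h0 x : 0 <= h x by rewrite addr_ge0// mulr_ge0 ?sqn_ge0.
have ch : continuous h := continuous_energy_density W_cont cu cu1.
have mh : measurable_fun setT h := continuous_measurable_fun ch.
have -> : H_energy W u = (\int[mu]_x (h x)%:E)%E.
  rewrite H_energyE; apply: ge0_ae_eq_integral => //.
  - apply/measurable_EFinP; apply: measurable_funD => //.
    apply: measurable_funM => //; apply: measurable_sqn => i.
    by case: (lg i).
  - exact/measurable_EFinP.
  - by move=> x _; rewrite lee_fin addr_ge0// mulr_ge0 ?sqn_ge0.
  - by move=> x _; rewrite lee_fin.
  - apply: (aeW2 _ gu gu) => x hx _ _; congr (_ %:E); congr (_ * _ + _).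
    by apply: eq_bigr => i _; rewrite hx.
pose F (n : nat) := `[- n%:R, n%:R]%classic : set R.
have hF n : (\int[mu]_(x in F n) (h x)%:E <= m%:E)%E.
  have nn : - n%:R <= n%:R :> R by rewrite (@le_trans _ _ 0)// oppr_le0.
  have hi := continuous_interval_integrable ch (- n%:R) n%:R.
  rewrite -[leLHS]fineK; last by apply: integrable_fin_num => //; exact: measurable_itv.
  rewrite lee_fin (le_trans _ (E _ _ nn))//.
  exact: (energy_integral_le W_cont du cu cu1 kin pot nn).
have lim : (\int[mu]_(x in F i) (h x)%:E @[i --> \oo] -->
    \int[mu]_(x in \bigcup_i F i) (h x)%:E)%E.
  apply: ge0_nondecreasing_set_cvg_integral.
  - move=> i j ij; apply/subsetPset => x; rewrite /F/= !in_itv/= => /andP[x1 x2].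
    have : i%:R <= j%:R :> R by rewrite ler_nat.
    by move=> ?; apply/andP; split; lra.
  - by move=> i; exact: measurable_itv.
  - by move=> i; apply/measurable_EFinP; exact: measurable_funTS.
  - by move=> i x _; rewrite lee_fin.
have <- : \bigcup_i F i = setT.
  rewrite -subTset => x _; exists (Num.truncn `|x|).+1 => //.
  by rewrite /F/= in_itv/= -ler_norml ltW// truncnS_gt.
by apply: (cvge_to_le lim); apply: nearW.
Qed.

End EnergyUpperBound.

(** * The heteroclinic connection *)

Lemma liminf_far (R : realType) (N : nat) (W : 'rV[R]_N -> R) :
  (0 < limf_einf (EFin \o W) (@at_infinity R N))%E ->
  exists c B : R, 0 < c /\ forall x, B < sqn x -> c <= W x.
Proof.
rewrite limf_einfE => /ereal_sup_gt[_ [A [M _ MA] <-] infA].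
have [c [c0 hc]] : exists c : R, 0 < c /\ forall x, A x -> c <= W x.
  have low x : A x -> (ereal_inf ((EFin \o W) @` A) <= (W x)%:E)%E.
    by move=> Ax; apply: ereal_inf_lbound; exists x.
  case: (ereal_inf _) infA low => [c|_ low|//].
    by rewrite lte_fin => c0 low; exists c; split => // x /low; rewrite lee_fin.
  by exists 1; split => // x /low.
exists c, (Num.max M 0 ^+ 2); split => // x hx; apply/hc/MA => /=.
have M0 : 0 <= Num.max M 0 by rewrite le_max lexx orbT.
by rewrite (@le_lt_trans _ _ (Num.max M 0)) ?le_max ?lexx// enorm_gt.
Qed.

Theorem corollary3p3 (R : realType) (N : nat) (hN : (2 <= N)%N)
  (W : 'rV[R]_N -> R)
  (W_ge0 : forall p, 0 <= W p)
  (W_cont : continuous W)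
  (W_liminf : (0 < limf_einf (EFin \o W) (@at_infinity R N))%E)
  (alpha : R) (halpha : 0 < alpha < 1)
  (W_reg : C1alpha_loc alpha (~` zero_set W) W)
  (C delta : R) (hC : 0 < C) (hdelta : 0 < delta)
  (W_quad : forall q, zero_set W q ->
     forall p, enorm (p - q) < delta -> W p <= C * enorm (p - q) ^+ 2)
  (p1 p2 : 'rV[R]_N) (hp : p1 <> p2)
  (hZ : zero_set W = [set p1; p2]) :
  exists U : R -> 'rV[R]_N, minimizing_heteroclinic W p1 p2 U.
Proof.
have W_zero x : W x = 0 <-> x = p1 \/ x = p2.
  by rewrite -[W x = 0]/(zero_set W x) hZ.
have W_far := liminf_far W_liminf.
have d2 : 0 < delta ^+ 2 by rewrite exprn_gt0.
have W_sqn z : W z = 0 -> forall x, sqn (x - z) < delta ^+ 2 -> W x <= C * sqn (x - z).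
  by move=> Wz x; rewrite -enorm_lt// -enorm_sqr => /W_quad; apply.
have W_diff x : W x <> 0 ->
    (\forall y \near x, differentiable W y) /\ {for x, continuous (grad W)}.
  have [dW cW _] := W_reg; move=> Wx; split; last exact: cW.
  have : \forall y \near x, W y != 0.
    by apply: (cvgr_neq0 _ (@W_cont x)); exact/eqP.
  by apply: filterS => y /eqP Wy; exact: dW.
have [m [u [q [p [u_adm u_min]]]]] :=
  exists_minimizer W_ge0 W_cont W_zero W_far hC d2 W_sqn hp.
have [Pu ua ub E] := u_adm.
have avoid t : W (u t) <> 0 := avoids_wells W_ge0 hp hC d2 W_sqn u_adm u_min (t := t).
have cu : continuous u.
  move=> t; apply/sqn_cvgP => e e0.
  by apply: holder_cvg e0 _; exact: (u_holder W_ge0 u_adm).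
pose f t := grad W (u t).
have cf : continuous f.
  by move=> t; exact: (continuous_cvg _ (W_diff _ (avoid t)).2 (cu t)).
have [u1 [du cu1 [uC2 uE]]] := coords_C2 cu cf (fun t i e e0 =>
  second_difference W_ge0 hp hC d2 W_sqn W_diff u_adm u_min t i e0).
exists u; split => //.
- by move=> x; rewrite uE subrr.
- by split; [exact: tends_Ny_cvg|exact: tends_y_cvg].
move=> V hV Vab.
apply: (le_trans (H_energy_classical_le W_ge0 W_cont du cu cu1 Pu E)).
have [Voo|] := ltP (H_energy W V) +oo%E; last exact: le_trans (leey _).
have [v [q' [p' v_adm]]] := H1loc_admissible W_ge0 W_cont hV Vab Voo.
rewrite -[leRHS]fineK; first by rewrite lee_fin; exact: u_min v_adm.
rewrite ge0_fin_numE// H_energyE; apply: integral_ge0 => x _.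
by rewrite lee_fin addr_ge0// mulr_ge0 ?sqn_ge0.
Qed.
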